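(* Let $X$ be a metric space which is uniformly contractible at infinity, let $R$ be a ring, and let $A\subset X$ be a nonempty subset such that $X\neq N_r(A)$ for any $r$. Then for all $*\ge 1$ $$HX^*(X-A;R)\cong\varinjlim_{r}\tilde H^{*-1}(X-N_r(A);R).$$
   Context: Uniformly contractible at infinity: there exist two non-decreasing functions $\rho,\mu:\mathbb{R}_+\to\mathbb{R}_+$ and a basepoint $b\in X$ such that any set $B\subset X$ of diameter $r$ with $d(b,B)\ge\mu(r)$ is contractible inside a set of diameter $\rho(r)$ (i.e. the inclusion of $B$ into some set of diameter at most $\rho(r)$ is null-homotopic). $N_r(A)$ is the $r$-neighborhood of $A$ in $X$. $\tilde H^*(\,\cdot\,;R)$ is reduced Alexander--Spanier cohomology; the direct limit is over $r\to\infty$ along restriction maps. Coarse cohomology: $C^n(X;R)$ is the set of all functions $\phi:X^{n+1}\to R$ with $(d\phi)(x_0,\dots,x_{n+1})=\sum_i(-1)^i\phi(x_0,\dots,\hat{x_i},\dots,x_{n+1})$. Let $X^\infty$ be the set of eventually constant sequences in $X$ with the sup metric, $i(x_0,\dots,x_n)=(x_0,\dots,x_n,x_n,\dots)$, $|\phi|=\{i(\sigma):\phi(\sigma)\neq0\}\subset X^\infty$, and $\Delta=i(X)$ the diagonal. $CX^n(X;R)=\{\phi\in C^n(X;R)\mid|\phi|\cap N_r(\Delta)\text{ is bounded for all }r\}$. Coarse cohomology of the complement: let $\mathcal S=\{B\subset X\mid N_r(B)\cap N_r(A)\text{ is bounded for any }r\ge0\}$. Then $HX^*(X-A;R)$ is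 the cohomology of the complex $CX^n(X-A;R)=\{\phi\in C^n(X;R)\mid\forall B\in\mathcal S,\ \phi|_B\in CX^n(B;R)\}$ with differential $d$ (this notation does not mean the coarse cohomology of the metric subspace $X\setminus A$). *)

(* Defs.v *)
From HB Require Import structures.
From mathcomp Require Import all_boot all_order all_algebra.
From mathcomp Require Import generic_quotient ring_quotient interval_inference.
From mathcomp Require Import zify.
From mathcomp Require Import all_classical all_reals ereal topology normedtype.

Set Implicit Arguments.
Unset Strict Implicit.
Unset Printing Implicit Defensive.

Import Order.TTheory GRing.Theory Num.Theory.
Import numFieldNormedType.Exports.

Local Open Scope classical_set_scope.
Local Open Scope ring_scope.
Local Open Scope quotient_scope.

(* Submodules of a module over a ring, bundled: over a ring, the library's
   submodClosed does not inherit from zmodClosed, which the quotient needs. *)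
Structure lmodClosed (R : pzRingType) (V : lmodType R) := LmodClosed {
  lmodClosed_pred :> {pred V};
  lmodClosedP : submod_closed lmodClosed_pred }.

HB.instance Definition _ (R : pzRingType) (V : lmodType R) (P : lmodClosed V) :=
  GRing.isSubmodClosed.Build R V (lmodClosed_pred P) (lmodClosedP P).

Section Submodules.
Variable R : pzRingType.
Implicit Types V W : lmodType R.

Definition submodule V (P : lmodClosed V) : Type := {x : V | x \in P}.

HB.instance Definition _ V (P : lmodClosed V) := SubChoice.on (submodule P).
HB.instance Definition _ V (P : lmodClosed V) :=
  [SubChoice_isSubLmodule of submodule P by <:].

Section SubMap.
Variables (V W : lmodType R) (f : {linear V -> W}).
Variables (P : lmodClosed V) (Q : lmodClosed W).
Hypothesis fPQ : forall x, x \in P -> f x \in Q.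

Definition sub_map (x : submodule P) : submodule Q :=
  Sub (f (val x)) (fPQ (valP x)).

Let sub_map_is_linear : linear sub_map.
Proof. by move=> a x y; apply: val_inj; rewrite /= !linearP. Qed.

HB.instance Definition _ :=
  GRing.isLinear.Build R (submodule P) (submodule Q) *:%R sub_map
    sub_map_is_linear.

End SubMap.

Lemma ker_closed V W (f : {linear V -> W}) :
  submod_closed (fun x => f x == 0 : bool).
Proof.
split; first by rewrite unfold_in linear0.
by move=> a x y; rewrite !unfold_in linearP => /eqP-> /eqP->; rewrite scaler0 addr0.
Qed.

Definition ker V W (f : {linear V -> W}) : lmodClosed V :=
  LmodClosed (ker_closed f).

Section QuotientModule.
Variables (V : lmodType R) (P : lmodClosed V).
Local Notation Q := (Quotient.quot P).

Definition quot_scale (a : R) (x : Q) : Q := \pi_Q (a *: repr x).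

Lemma quot_eqE (x y : V) : (\pi_Q x == \pi_Q y) = (x - y \in P).
Proof. by rewrite -Quotient.idealrBE. Qed.

Lemma repr_pi_sub (x : V) : repr (\pi_Q x) - x \in P.
Proof. by rewrite -quot_eqE reprK. Qed.

Lemma quot_pi_add (x y : V) : \pi_Q (x + y) = \pi_Q x + \pi_Q y.
Proof. exact: (@pi_addr _ _ _ _ _ Q). Qed.

Lemma pi_scale a (x : V) : quot_scale a (\pi_Q x) = \pi_Q (a *: x).
Proof. by apply/eqP; rewrite quot_eqE -scalerBr rpredZ// repr_pi_sub. Qed.

Let scaleqA a b x : quot_scale a (quot_scale b x) = quot_scale (a * b) x.
Proof. by rewrite -[x]reprK (pi_scale b) !pi_scale scalerA. Qed.

Let scale1q : left_id 1 quot_scale.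
Proof. by move=> x; rewrite -[x]reprK pi_scale scale1r. Qed.

Let scaleqDr : right_distributive quot_scale +%R.
Proof.
move=> a x y; rewrite -[x]reprK -[y]reprK -quot_pi_add !pi_scale.
by rewrite scalerDr quot_pi_add.
Qed.

Let scaleqDl x : {morph quot_scale^~ x : a b / a + b}.
Proof.
by move=> a b /=; rewrite -[x]reprK !pi_scale scalerDl quot_pi_add.
Qed.

HB.instance Definition _ := GRing.Zmodule_isLmodule.Build R Q
  scaleqA scale1q scaleqDr scaleqDl.

Let pi_is_linear : linear \pi_Q.
Proof. by move=> a x y; rewrite quot_pi_add -pi_scale. Qed.

Definition quot_pi (x : V) : Q := \pi_Q x.

HB.instance Definition _ :=
  GRing.isLinear.Build R V Q *:%R quot_pi pi_is_linear.

Lemma quot_piE (x y : V) : (quot_pi x == quot_pi y) = (x - y \in P).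
Proof. exact: quot_eqE. Qed.

Lemma quot_pi_repr (x : Q) : quot_pi (repr x) = x.
Proof. exact: reprK. Qed.

End QuotientModule.

Section QuotMap.
Variables (V W : lmodType R) (f : {linear V -> W}).
Variables (P : lmodClosed V) (Q : lmodClosed W).

Definition quot_map of (forall x, x \in P -> f x \in Q) :=
  fun x : Quotient.quot P => quot_pi Q (f (repr x)).

Variable fPQ : forall x, x \in P -> f x \in Q.

Lemma quot_map_pi (x : V) : quot_map fPQ (quot_pi P x) = quot_pi Q (f x).
Proof. by apply/eqP; rewrite quot_piE -linearB fPQ// repr_pi_sub. Qed.

Let quot_map_is_linear : linear (quot_map fPQ).
Proof.
move=> a x y; rewrite -(quot_pi_repr x) -(quot_pi_repr y) -linearP.
by rewrite !quot_map_pi !linearP.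
Qed.

HB.instance Definition _ :=
  GRing.isLinear.Build R (Quotient.quot P) (Quotient.quot Q) *:%R (quot_map fPQ)
    quot_map_is_linear.

End QuotMap.

Definition lmod_isomorphic V W := exists f : {linear V -> W}, bijective f.

End Submodules.

Arguments sub_map {R V W} f {P Q} fPQ.
Arguments quot_map {R V W} f {P Q} fPQ.

Section Cohomology.
Variable R : pzRingType.

Structure cochain_complex := CochainComplex {
  cochain_obj :> nat -> lmodType R;
  cochain_d : forall n, {linear cochain_obj n -> cochain_obj n.+1};
  cochain_dK : forall n x, cochain_d n.+1 (cochain_d n x) = 0 }.

Structure cochain_map (C D : cochain_complex) := CochainMap {
  cochain_fun :> forall n, {linear C n -> D n};
  cochain_funE : forall n x,
    cochain_fun n.+1 (cochain_d C n x) = cochain_d D n (cochain_fun n x) }.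

Definition cocycle (C : cochain_complex) n : Type :=
  submodule (ker (cochain_d C n)).

HB.instance Definition _ (C : cochain_complex) n :=
  GRing.SubLmodule.on (cocycle C n).

(* There is no cochain in degree -1. *)
Definition coboundary (C : cochain_complex) n : set (C n) :=
  match n with 0 => [set 0] | m.+1 => range (cochain_d C m) end.

Lemma coboundary_closed (C : cochain_complex) n :
  submod_closed (fun z : cocycle C n => `[< coboundary (val z) >]).
Proof.
split=> [|a x y]; rewrite !unfold_in.
  apply/asboolP; rewrite /coboundary; case: n => [|m] //=.
  by exists 0; rewrite ?linear0.
move=> /asboolP xB /asboolP yB; apply/asboolP.
have -> : val (a *: x + y) = a *: val x + val y by [].
case: n x y xB yB => [|m] x y /=; first by move=> -> ->; rewrite scaler0 addr0.
by move=> [u _ <-] [v _ <-]; exists (a *: u + v); rewrite ?linearP.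
Qed.

Definition coboundaries (C : cochain_complex) n : lmodClosed (cocycle C n) :=
  LmodClosed (@coboundary_closed C n).

Definition cohomology (C : cochain_complex) n : lmodType R :=
  Quotient.quot (coboundaries C n).

Section CohomologyMap.
Variables (C D : cochain_complex) (f : cochain_map C D) (n : nat).

Lemma cochain_map_cocycle x :
  x \in ker (cochain_d C n) -> f n x \in ker (cochain_d D n).
Proof. by rewrite !unfold_in -cochain_funE => /eqP->; rewrite linear0. Qed.

Definition cocycle_map : {linear cocycle C n -> cocycle D n} :=
  sub_map (f n) cochain_map_cocycle.

Lemma cochain_map_coboundary z :
  z \in coboundaries C n -> cocycle_map z \in coboundaries D n.
Proof.
rewrite !unfold_in => /asboolP zB; apply/asboolP.
suff fB x : coboundary x -> coboundary (f n x) by exact: fB zB.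
case: n x {z zB} => [|m] x /=; first by move=> ->; rewrite linear0.
by move=> [y _ <-]; exists (f m y); rewrite ?cochain_funE.
Qed.

Definition cohomology_map : {linear cohomology C n -> cohomology D n} :=
  quot_map cocycle_map cochain_map_coboundary.

Lemma cohomology_map_pi z :
  cohomology_map (quot_pi _ z) = quot_pi _ (cocycle_map z).
Proof. exact: quot_map_pi. Qed.

End CohomologyMap.

Lemma cohomology_map_id (C : cochain_complex) (f : cochain_map C C) n :
  (forall x, f n x = x) -> forall x, cohomology_map f n x = x.
Proof.
move=> fid x; rewrite -(quot_pi_repr x); move: (repr x) => z.
apply: etrans (cohomology_map_pi f z) _; congr quot_pi.
by apply: val_inj; exact: fid.
Qed.

Lemma cohomology_map_comp (C D E : cochain_complex) (f : cochain_map C D)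
    (g : cochain_map D E) (h : cochain_map C E) n :
  (forall x, g n (f n x) = h n x) ->
  forall x, cohomology_map g n (cohomology_map f n x) = cohomology_map h n x.
Proof.
move=> gfh x; rewrite -(quot_pi_repr x); move: (repr x) => z.
apply: etrans (congr1 _ (cohomology_map_pi f z)) _.
apply: etrans (cohomology_map_pi g _) _.
apply: etrans _ (esym (cohomology_map_pi h z)); congr quot_pi.
by apply: val_inj; exact: gfh.
Qed.

End Cohomology.

(* Direct systems indexed by the ordered set of real numbers; the direct limit
   is the disjoint union of the terms, two elements being identified when they
   become equal further along the system. *)
Section DirectLimit.
Variables (K : realType) (R : pzRingType).

Structure direct_system := DirectSystem {
  dsys_obj :> K -> lmodType R;
  dsys_map : forall i j, i <= j -> {linear dsys_obj i -> dsys_obj j};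
  dsys_map_id : forall i (h : i <= i) x, dsys_map h x = x;
  dsys_map_comp : forall i j k (hij : i <= j) (hjk : j <= k) (hik : i <= k) x,
    dsys_map hjk (dsys_map hij x) = dsys_map hik x }.

Variable D : direct_system.

Lemma max_gel (i j : K) : i <= Num.max i j. Proof. by rewrite le_max lexx. Qed.
Lemma max_ger (i j : K) : j <= Num.max i j. Proof. by rewrite le_max lexx orbT. Qed.

Definition dlim_rel (x y : {i : K & D i}) : bool :=
  `[< exists k (hx : tag x <= k) (hy : tag y <= k),
      dsys_map D hx (tagged x) = dsys_map D hy (tagged y) >].

Lemma dlim_rel_equiv : equiv_class_of dlim_rel.
Proof.
split.
- by move=> x; apply/asboolP; exists (tag x), (lexx _), (lexx _).
- by move=> x y; apply/asboolP/asboolP => -[k [hx [hy e]]]; exists k, hy, hx.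
- move=> y x z /asboolP[k [hx [hy e]]] /asboolP[l [hy' [hz e']]].
  apply/asboolP.
  have hk : k <= Num.max k l by rewrite le_max lexx.
  have hl : l <= Num.max k l by rewrite le_max lexx orbT.
  exists (Num.max k l), (le_trans hx hk), (le_trans hz hl).
  rewrite -(dsys_map_comp hx hk) e -(dsys_map_comp hz hl) -e'.
  by rewrite !(dsys_map_comp _ _ (le_trans hy hk)).
Qed.

Canonical dlim_rel_equivRel := EquivRelPack dlim_rel_equiv.
Canonical dlim_rel_encModRel := defaultEncModRel dlim_rel.

Definition dlim : Type := {eq_quot dlim_rel}.
HB.instance Definition _ := EqQuotient.on dlim.
HB.instance Definition _ := Choice.on dlim.

Definition dlim_in i (x : D i) : dlim := \pi_dlim (Tagged (fun j => D j) x).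

Lemma dlim_inP i j (x : D i) (y : D j) :
  dlim_in x = dlim_in y <->
  exists k (hi : i <= k) (hj : j <= k), dsys_map D hi x = dsys_map D hj y.
Proof.
split=> [/eqP|xy]; first by rewrite piE => /asboolP.
by apply/eqP; rewrite piE; apply/asboolP.
Qed.

Lemma dlim_in_map i j (h : i <= j) (x : D i) :
  dlim_in (dsys_map D h x) = dlim_in x.
Proof.
by apply/dlim_inP; exists j, (lexx j), h; rewrite dsys_map_id.
Qed.

Lemma dlim_inW (q : dlim) : exists i (x : D i), q = dlim_in x.
Proof.
by exists (tag (repr q)), (tagged (repr q)); rewrite /dlim_in taggedK reprK.
Qed.

Lemma dlim_in2 (p q : dlim) :
  exists i (x y : D i), p = dlim_in x /\ q = dlim_in y.
Proof.
have [i [x ->]] := dlim_inW p; have [j [y ->]] := dlim_inW q.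
have hi : i <= Num.max i j by rewrite le_max lexx.
have hj : j <= Num.max i j by rewrite le_max lexx orbT.
by exists (Num.max i j), (dsys_map D hi x), (dsys_map D hj y); rewrite !dlim_in_map.
Qed.

Lemma dlim_in3 (p q r : dlim) :
  exists i (x y z : D i), [/\ p = dlim_in x, q = dlim_in y & r = dlim_in z].
Proof.
have [i [x [y [-> ->]]]] := dlim_in2 p q; have [j [z ->]] := dlim_inW r.
have hi : i <= Num.max i j by rewrite le_max lexx.
have hj : j <= Num.max i j by rewrite le_max lexx orbT.
exists (Num.max i j), (dsys_map D hi x), (dsys_map D hi y), (dsys_map D hj z).
by rewrite !dlim_in_map.
Qed.

Definition dlim_zero : dlim := dlim_in (0 : D 0).

Definition dlim_opp (p : dlim) : dlim := dlim_in (- tagged (repr p)).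

Definition dlim_scale (a : R) (p : dlim) : dlim :=
  dlim_in (a *: tagged (repr p)).

Definition dlim_add (p q : dlim) : dlim :=
  let x := repr p in let y := repr q in
  dlim_in (dsys_map D (max_gel (tag x) (tag y)) (tagged x) +
           dsys_map D (max_ger (tag x) (tag y)) (tagged y)).

Lemma dlim_repr i (x : D i) :
  exists k (h : i <= k) (h' : tag (repr (dlim_in x)) <= k),
    dsys_map D h x = dsys_map D h' (tagged (repr (dlim_in x))).
Proof. by apply/dlim_inP; rewrite /dlim_in taggedK reprK. Qed.

Lemma dlim_zero_in i : dlim_zero = dlim_in (0 : D i).
Proof.
by apply/dlim_inP; exists (Num.max 0 i), (max_gel _ _), (max_ger _ _); rewrite !linear0.
Qed.

Lemma dlim_opp_in i (x : D i) : dlim_opp (dlim_in x) = dlim_in (- x).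
Proof.
have [k [h [h' e]]] := dlim_repr x.
by apply/dlim_inP; exists k, h', h; rewrite !linearN -e.
Qed.

Lemma dlim_scale_in a i (x : D i) : dlim_scale a (dlim_in x) = dlim_in (a *: x).
Proof.
have [k [h [h' e]]] := dlim_repr x.
by apply/dlim_inP; exists k, h', h; rewrite !linearZ -e.
Qed.

Lemma dlim_add_in i (x y : D i) :
  dlim_add (dlim_in x) (dlim_in y) = dlim_in (x + y).
Proof.
have [k [h [h' e]]] := dlim_repr x; have [l [g [g' e']]] := dlim_repr y.
have hk := max_gel k l; have hl := max_ger k l.
have hm : Num.max (tag (repr (dlim_in x))) (tag (repr (dlim_in y))) <= Num.max k l.
  by rewrite ge_max (le_trans h' hk) (le_trans g' hl).
apply/dlim_inP; exists (Num.max k l), hm, (le_trans h hk).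
rewrite !linearD !(dsys_map_comp _ _ (le_trans h' hk)).
rewrite !(dsys_map_comp _ _ (le_trans g' hl)).
rewrite -(dsys_map_comp h' hk) -e (dsys_map_comp _ _ (le_trans h hk)).
by rewrite -(dsys_map_comp g' hl) -e' (dsys_map_comp _ _ (le_trans h hk)).
Qed.

Let dlim_addA : associative dlim_add.
Proof.
move=> p q r; have [i [x [y [z [-> -> ->]]]]] := dlim_in3 p q r.
by rewrite !dlim_add_in addrA.
Qed.

Let dlim_addC : commutative dlim_add.
Proof.
move=> p q; have [i [x [y [-> ->]]]] := dlim_in2 p q.
by rewrite !dlim_add_in addrC.
Qed.

Let dlim_add0 : left_id dlim_zero dlim_add.
Proof.
by move=> p; have [i [x ->]] := dlim_inW p; rewrite (dlim_zero_in i) dlim_add_in add0r.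
Qed.

Let dlim_addN : left_inverse dlim_zero dlim_opp dlim_add.
Proof.
move=> p; have [i [x ->]] := dlim_inW p.
by rewrite (dlim_zero_in i) dlim_opp_in dlim_add_in addNr.
Qed.

HB.instance Definition _ :=
  GRing.isZmodule.Build dlim dlim_addA dlim_addC dlim_add0 dlim_addN.

Lemma dlim_inD i (x y : D i) : dlim_in (x + y) = dlim_in x + dlim_in y.
Proof. by rewrite -dlim_add_in. Qed.

Let dlim_scaleA a b p : dlim_scale a (dlim_scale b p) = dlim_scale (a * b) p.
Proof. by have [i [x ->]] := dlim_inW p; rewrite !dlim_scale_in scalerA. Qed.

Let dlim_scale1 : left_id 1 dlim_scale.
Proof.
by move=> p; have [i [x ->]] := dlim_inW p; rewrite dlim_scale_in scale1r.
Qed.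

Let dlim_scaleDr : right_distributive dlim_scale +%R.
Proof.
move=> a p q; have [i [x [y [-> ->]]]] := dlim_in2 p q.
by rewrite -dlim_inD !dlim_scale_in scalerDr dlim_inD.
Qed.

Let dlim_scaleDl p : {morph dlim_scale^~ p : a b / a + b}.
Proof.
move=> a b; have [i [x ->]] := dlim_inW p.
by rewrite !dlim_scale_in scalerDl dlim_inD.
Qed.

HB.instance Definition _ := GRing.Zmodule_isLmodule.Build R dlim
  dlim_scaleA dlim_scale1 dlim_scaleDr dlim_scaleDl.

Let dlim_in_is_linear i : linear (@dlim_in i).
Proof. by move=> a x y; rewrite dlim_inD -dlim_scale_in. Qed.

HB.instance Definition _ i :=
  GRing.isLinear.Build R (D i) dlim *:%R (@dlim_in i) (@dlim_in_is_linear i).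

End DirectLimit.

Section FunctionCochains.
Variable R : pzRingType.
Implicit Type T : Type.

Definition cochains T n : lmodType R := ('I_n.+1 -> T) -> R^o.

Definition cochain_delta T n (phi : cochains T n) : cochains T n.+1 :=
  fun s => \sum_(i < n.+2) (-1) ^+ i * phi (s \o lift i).

Section Delta.
Variables (T : Type) (n : nat).

Let delta_is_linear : linear (@cochain_delta T n).
Proof.
move=> a x y; apply/funext => s; rewrite /cochain_delta.
rewrite [RHS](_ : _ = a * \sum_(i < n.+2) (-1) ^+ i * x (s \o lift i) +
  \sum_(i < n.+2) (-1) ^+ i * y (s \o lift i))//.
rewrite mulr_sumr -big_split; apply: eq_bigr => i _ /=.
rewrite -[in LHS]/(a * x (s \o lift i) + y (s \o lift i)) mulrDr !mulrA.
by rewrite (commr_sign a i).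
Qed.

HB.instance Definition _ := GRing.isLinear.Build R (cochains T n)
  (cochains T n.+1) *:%R (@cochain_delta T n) delta_is_linear.

End Delta.

Lemma cochain_deltaK T n (phi : cochains T n) :
  cochain_delta (cochain_delta phi) = 0.
Proof.
apply/funext => s; rewrite /cochain_delta.
under eq_bigr do rewrite mulr_sumr.
rewrite pair_big /=.
rewrite (bigID (fun p : 'I_n.+3 * 'I_n.+2 => (p.2 < p.1)%N)) /=.
rewrite [X in _ + X](reindex_onto
  (fun p : 'I_n.+3 * 'I_n.+2 => (inord p.2, inord p.1.-1))
  (fun p : 'I_n.+3 * 'I_n.+2 => (inord p.2.+1, inord p.1))) /=; last first.
  move=> [i j] /=; rewrite -leqNgt => ij; congr pair; apply: val_inj => /=.
    by have ? := ltn_ord j; rewrite !inordK; lia.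
  by have ? := ltn_ord j; rewrite !inordK /=; lia.
rewrite [X in _ + X](eq_bigl (fun p : 'I_n.+3 * 'I_n.+2 => (p.2 < p.1)%N)); last first.
  move=> [[i hi] [j hj]] /=; rewrite !inordK; try lia.
  apply/andP/idP => [[]|ji].
    rewrite -leqNgt => ij /eqP[] /(congr1 val) /=.
    case: i hi ij => [|i] hi ij /=.
      by rewrite inordK.
    by move=> _ _; rewrite ltnS.
  case: i hi ji => [//|i] hi ji /=; split; first by rewrite -ltnNge.
  by apply/eqP; congr pair; apply: val_inj; rewrite /= inordK// ltnW.
rewrite -big_split big1// => -[[i hi] [j hj]] /= ji.
set u := _ * (_ * _); set v := _ * (_ * _).
have -> : v = - u; last by rewrite subrr.
rewrite /u /v !inordK; try lia.
case: i hi ji @u @v => [//|i] hi ji u v.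
rewrite !mulrA -!exprD -mulNr; congr (_ * phi _).
  by rewrite addnC /= addSn exprS mulN1r opprK.
apply/funext => k; rewrite /= ; congr s; apply: val_inj => /=.
rewrite !inordK// /bump; last exact: ltnW.
rewrite ltnS in ji.
case: (leqP j k) => jk; case: (leqP i k) => ik /=; lia.
Qed.

Definition cochain_pull T T' (f : T -> T') n (phi : cochains T' n) :
  cochains T n := fun s => phi (f \o s).

HB.instance Definition _ T T' (f : T -> T') n :=
  GRing.isLinear.Build R (cochains T' n) (cochains T n) *:%R
    (@cochain_pull T T' f n) (fun _ _ _ => erefl).

Lemma cochain_pull_delta T T' (f : T -> T') n (phi : cochains T' n) :
  cochain_pull f (cochain_delta phi) = cochain_delta (cochain_pull f phi).
Proof. by []. Qed.

End FunctionCochains.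

Section MetricNotions.
Variables (K : realType) (X : metricType K).
Implicit Types (A B D : set X) (r : K).

(* Open r-neighborhood. *)
Definition rnbhd r A : set X := \bigcup_(a in A) ball a r.

(* The empty set has diameter -oo. *)
Definition diameter A : \bar K :=
  ereal_sup [set (mdist xy.1 xy.2)%:E | xy in A `*` A].

Definition metric_bounded A :=
  exists M, forall x y, A x -> A y -> mdist x y <= M.

(* H is only relevant on [0, 1] x B, with values in D; there it is continuous
   for the subspace topology. *)
Definition homotopic_within B D (f g : X -> X) :=
  exists H : K * X -> X,
    [/\ {within `[0, 1] `*` B, continuous H},
        (forall t x, t \in `[0, 1] -> B x -> D (H (t, x))),
        (forall x, B x -> H (0, x) = f x) &
        (forall x, B x -> H (1, x) = g x)].

Definition contractible_inside B D :=
  B `<=` D /\ exists2 c, D c & homotopic_within B D id (cst c).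

Definition unif_contractible_at_infinity :=
  exists (rho mu : {nonneg K} -> {nonneg K}) (b : X),
    [/\ {homo rho : x y / x <= y}, {homo mu : x y / x <= y} &
        forall (r : {nonneg K}) B,
          diameter B = (r%:num)%:E ->
          (((mu r)%:num)%:E <= edist_inf B b)%E ->
          exists2 D, (diameter D <= ((rho r)%:num)%:E)%E &
                     contractible_inside B D].

End MetricNotions.

Section SubsetMetric.
Variables (K : realType) (X : metricType K) (B : set X).

Let sub_mdist (x y : B) : K := mdist (val x) (val y).

Let sub_mdist_ge0 x y : 0 <= sub_mdist x y. Proof. exact: mdist_ge0. Qed.

Let sub_mdist_eq0 x y : sub_mdist x y = 0 -> x = y.
Proof. by move=> /mdist_positivity/val_inj. Qed.

Let sub_ball (x : B) (d : K) : ball x d = [set y | sub_mdist x y < d].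
Proof. by rewrite -initial_ballE ballEmdist. Qed.

HB.instance Definition _ := PseudoMetric_isMetric.Build K (set_type B)
  sub_mdist_ge0 sub_mdist_eq0 sub_ball.

End SubsetMetric.

Section EventuallyConstant.
Variables (K : realType) (X : metricType K).

Definition eventually_constant (s : nat -> X) :=
  exists N, forall n, (N <= n)%N -> s n = s N.

Definition evconst : Type := {s : nat -> X | `[< eventually_constant s >]}.

HB.instance Definition _ := SubChoice.on evconst.

(* The supremum is over a bounded set, see sup_dist_has_sup. *)
Definition sup_dist (s t : evconst) : K :=
  sup (range (fun n => mdist (val s n) (val t n))).

Lemma sup_dist_has_sup (s t : evconst) :
  has_sup (range (fun n => mdist (val s n) (val t n))).
Proof.
split; first by exists (mdist (val s 0%N) (val t 0%N)), 0%N.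
have /asboolP[N sN] := valP s; have /asboolP[M tM] := valP t.
pose f n := mdist (val s n) (val t n).
exists (\sum_(i < (maxn N M).+1) f i) => _ [n _ <-]; rewrite -/(f n).
have f0 i : 0 <= f i by exact: mdist_ge0.
have [nNM|NMn] := leqP n (maxn N M).
  by rewrite (bigD1 (Ordinal (nNM : (n < (maxn N M).+1)%N)))//= lerDl sumr_ge0.
have -> : f n = f (maxn N M).
  rewrite /f (sN n) ?(tM n) ?(sN (maxn N M)) ?(tM (maxn N M))//; lia.
by rewrite (bigD1 ord_max)//= lerDl sumr_ge0.
Qed.

Lemma mdist_le_sup_dist (s t : evconst) n :
  mdist (val s n) (val t n) <= sup_dist s t.
Proof. by apply: (sup_upper_bound (sup_dist_has_sup s t)); exists n. Qed.

Lemma sup_dist_le (s t : evconst) M :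
  (forall n, mdist (val s n) (val t n) <= M) -> sup_dist s t <= M.
Proof.
by move=> h; apply: sup_le_ub => [|_ [n _ <-]//]; exact: (sup_dist_has_sup s t).1.
Qed.

Let sup_distxx s : sup_dist s s = 0.
Proof.
apply/le_anti/andP; split; first by apply: sup_dist_le => n; rewrite mdistxx.
by rewrite (le_trans _ (mdist_le_sup_dist s s 0))// mdist_ge0.
Qed.

Let sup_dist_eq0 s t : sup_dist s t = 0 -> s = t.
Proof.
move=> st0; apply/val_inj/funext => n; apply: mdist_positivity.
by apply/le_anti; rewrite mdist_ge0 -st0 mdist_le_sup_dist.
Qed.

Let sup_distC s t : sup_dist s t = sup_dist t s.
Proof.
by congr (sup _); apply/seteqP; split=> _ [n _ <-]; exists n => //; rewrite metric_sym.
Qed.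

Let sup_dist_triangle t s u : sup_dist s u <= sup_dist s t + sup_dist t u.
Proof.
apply: sup_dist_le => n; apply: le_trans (metric_triangle _ (val t n) _) _.
by rewrite lerD ?mdist_le_sup_dist.
Qed.

HB.instance Definition _ := isMetric.Build K evconst
  sup_distxx sup_dist_eq0 sup_distC sup_dist_triangle.

Lemma evconst_incl_subproof n (s : 'I_n.+1 -> X) :
  `[< eventually_constant (fun k => s (inord (minn k n))) >].
Proof. by apply/asboolP; exists n => k nk; rewrite minnn (minn_idPr nk). Qed.

(* (x_0, ..., x_n) |-> (x_0, ..., x_n, x_n, ...) *)
Definition evconst_incl n (s : 'I_n.+1 -> X) : evconst :=
  Sub (fun k => s (inord (minn k n))) (evconst_incl_subproof s).

Definition diagonal_evconst : set evconst := range (@evconst_incl 0).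

End EventuallyConstant.

Section CoarseCochains.
Variables (K : realType) (R : pzRingType).

Definition coarse_support (X : metricType K) n (phi : cochains R X n) :
  set (evconst X) := [set evconst_incl s | s in [set s | phi s <> 0]].

Definition coarse_cochain (X : metricType K) n (phi : cochains R X n) : Prop :=
  forall r : K,
    metric_bounded (coarse_support phi `&` rnbhd r (@diagonal_evconst K X)).

Lemma metric_boundedS (X : metricType K) (A B : set X) :
  A `<=` B -> metric_bounded B -> metric_bounded A.
Proof. by move=> AB [M BM]; exists M => x y /AB ? /AB ?; apply: BM. Qed.

Lemma metric_boundedU (X : metricType K) (A B : set X) :
  metric_bounded A -> metric_bounded B -> metric_bounded (A `|` B).
Proof.
move=> [M AM] [N BN].
have [->|/set0P[a Aa]] := eqVneq A set0; first by rewrite set0U; exists N.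
have [->|/set0P[b Bb]] := eqVneq B set0; first by rewrite setU0; exists M.
have M0 : 0 <= M by rewrite -(mdistxx a) AM.
have N0 : 0 <= N by rewrite -(mdistxx b) BN.
have ABM x y : A x -> B y -> mdist x y <= M + mdist a b + N.
  move=> Ax By; rewrite (le_trans (metric_triangle _ b _))// lerD ?BN//.
  by rewrite (le_trans (metric_triangle _ a _))// lerD2r AM.
have d0 : 0 <= mdist a b by exact: mdist_ge0.
exists (M + mdist a b + N) => x y [Ax|Bx] [Ay|By].
- by rewrite (le_trans (AM _ _ Ax Ay))// -addrA lerDl addr_ge0.
- exact: ABM.
- by rewrite metric_sym ABM.
- by rewrite (le_trans (BN _ _ Bx By))// lerDr addr_ge0.
Qed.

Lemma coarse_cochain_closed (X : metricType K) n :
  submod_closed (fun phi : cochains R X n => `[< coarse_cochain phi >]).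
Proof.
split=> [|a x y]; rewrite !unfold_in.
  by apply/asboolP => r; exists 0 => s t [[? /=]].
move=> /asboolP xC /asboolP yC; apply/asboolP => r.
apply: metric_boundedS (metric_boundedU (xC r) (yC r)).
move=> _ [[s /= axy <-] sD]; have [x0|x0] := pselect (x s = 0); last first.
  by left; split => //; exists s.
right; split => //; exists s => //= y0; apply: axy.
by rewrite -[LHS]/(a * x s + y s) x0 y0 mulr0 addr0.
Qed.

Lemma evconst_inclE (X : metricType K) n (s : 'I_n.+1 -> X) (i : 'I_n.+1) :
  val (evconst_incl s) i = s i.
Proof.
have h : minn i n = i by apply/minn_idPl; rewrite -ltnS.
by rewrite /= h inord_val.
Qed.

Lemma evconst_incl_diag (X : metricType K) (x : 'I_1 -> X) k :
  val (evconst_incl x) k = x ord0.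
Proof. by rewrite /= (ord1 (inord _)). Qed.

Lemma rnbhd_diagonalP (X : metricType K) r n (s : 'I_n.+1 -> X) :
  rnbhd r (@diagonal_evconst K X) (evconst_incl s) ->
  exists2 x, (forall i, mdist x (s i) < r) &
  forall m (t : 'I_m.+1 -> X), (forall i, exists j, t i = s j) ->
    rnbhd r (@diagonal_evconst K X) (evconst_incl t).
Proof.
move=> [_ [x _ <-]]; rewrite ballEmdist => xs.
have xsE i : mdist (x ord0) (s i) <= mdist (evconst_incl x) (evconst_incl s).
  have := mdist_le_sup_dist (evconst_incl x) (evconst_incl s) i.
  by rewrite evconst_inclE evconst_incl_diag.
exists (x ord0) => [i|m t ts]; first exact: le_lt_trans (xsE i) xs.
exists (evconst_incl x); first by exists x.
rewrite ballEmdist; apply: le_lt_trans xs; apply: sup_dist_le => k.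
rewrite evconst_incl_diag; have [j /= ->] := ts (inord (minn k m)).
exact: xsE.
Qed.

Lemma coarse_cochain_delta (X : metricType K) n (phi : cochains R X n) :
  coarse_cochain phi -> coarse_cochain (cochain_delta phi).
Proof.
move=> phiC r; have [M phiM] := phiC r; exists (M + r *+ 4) => u v.
have face w : (coarse_support (cochain_delta phi) `&` rnbhd r (@diagonal_evconst K X)) w ->
    exists2 t, (coarse_support phi `&` rnbhd r (@diagonal_evconst K X)) t & mdist w t <= r *+ 2.
  move=> [[s /= phis <-] /rnbhd_diagonalP[x xs sD]].
  have [i phisi] : exists i : 'I_n.+2, phi (s \o lift i) <> 0.
    apply/existsNP => phi0; apply: phis; rewrite /cochain_delta big1// => i _.
    by rewrite phi0 mulr0.
  exists (evconst_incl (s \o lift i)).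
    split; first by exists (s \o lift i).
    by apply: sD => j; exists (lift i j).
  apply: sup_dist_le => k /=.
  rewrite (le_trans (metric_triangle _ x _))// mulr2n lerD//.
    by rewrite metric_sym ltW.
  exact/ltW/xs.
move=> /face[u' u'B uu'] /face[v' v'B vv'].
rewrite (le_trans (metric_triangle _ u' _))// addrC.
rewrite (le_trans (lerD (metric_triangle _ v' _) uu'))//.
rewrite [mdist v' v]metric_sym.
rewrite (le_trans (lerD (lerD (phiM _ _ u'B v'B) vv') (lexx _)))//.
by rewrite -addrA -mulrnDr.
Qed.

Variables (X : metricType K) (A : set X).

Definition coarsely_disjoint (B : set X) :=
  forall r : K, 0 <= r -> metric_bounded (rnbhd r B `&` rnbhd r A).

(* The n-cochains of the coarse cohomology of the complement of A. They are
   defined on all of X, not on the subset X \ A. *)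
Definition compl_coarse_cochain n (phi : cochains R X n) : Prop :=
  forall B : set X, coarsely_disjoint B ->
    coarse_cochain (cochain_pull (val : B -> X) phi).

Lemma compl_coarse_cochain_closed n :
  submod_closed (fun phi : cochains R X n => `[< compl_coarse_cochain phi >]).
Proof.
split=> [|a x y]; rewrite !unfold_in.
  apply/asboolP => B _; apply/asboolP; exact: (coarse_cochain_closed _ _).1.
move=> /asboolP xC /asboolP yC; apply/asboolP => B AB; apply/asboolP.
apply: (coarse_cochain_closed _ _).2; apply/asboolP; [exact: xC|exact: yC].
Qed.

Definition compl_coarse_cochains n : lmodClosed (cochains R X n) :=
  LmodClosed (@compl_coarse_cochain_closed n).

Lemma compl_coarse_cochains_delta n (phi : cochains R X n) :
  phi \in compl_coarse_cochains n ->
  cochain_delta phi \in compl_coarse_cochains n.+1.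
Proof.
move=> /asboolP phiC; apply/asboolP => B AB.
by rewrite cochain_pull_delta; apply/coarse_cochain_delta/phiC.
Qed.

Lemma compl_coarse_complex_subproof n (phi : submodule (compl_coarse_cochains n)) :
  sub_map (@cochain_delta R X n.+1) (@compl_coarse_cochains_delta n.+1)
    (sub_map (@cochain_delta R X n) (@compl_coarse_cochains_delta n) phi) = 0.
Proof. by apply: val_inj; rewrite /= cochain_deltaK. Qed.

Definition compl_coarse_complex : cochain_complex R :=
  CochainComplex (cochain_obj := fun n => submodule (compl_coarse_cochains n))
    compl_coarse_complex_subproof.

Definition compl_coarse_cohomology n : lmodType R :=
  cohomology compl_coarse_complex n.

End CoarseCochains.

Section AlexanderSpanier.
Variable R : pzRingType.

(* Alexander-Spanier n-cochains are arbitrary n-cochains modulo those which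
   vanish on V^{n+1} for every V in some open cover. *)
Definition locally_zero (T : topologicalType) n (phi : cochains R T n) : Prop :=
  exists U : set (set T),
    [/\ forall V, U V -> open V,
        \bigcup_(V in U) V = setT &
        forall V, U V -> forall s, (forall i, V (s i)) -> phi s = 0].

Lemma locally_zero_closed (T : topologicalType) n :
  submod_closed (fun phi : cochains R T n => `[< locally_zero phi >]).
Proof.
split=> [|a x y]; rewrite !unfold_in.
  apply/asboolP; exists [set setT]; split=> [V ->||//]; last exact: bigcup_set1.
  exact: openT.
move=> /asboolP[U [Uo UT xU]] /asboolP[W [Wo WT yW]]; apply/asboolP.
exists [set V | exists2 V1, U V1 & exists2 V2, W V2 & V = V1 `&` V2]; split.
- by move=> _ [V1 UV1 [V2 WV2 ->]]; apply: openI; [exact: Uo|exact: Wo].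
- apply/seteqP; split=> // t _.
  have [V1 UV1 V1t] : (\bigcup_(V in U) V) t by rewrite UT.
  have [V2 WV2 V2t] : (\bigcup_(V in W) V) t by rewrite WT.
  by exists (V1 `&` V2) => //; exists V1 => //; exists V2.
move=> _ [V1 UV1 [V2 WV2 ->]] s sV; rewrite -[LHS]/(a * x s + y s).
rewrite (xU _ UV1) ?(yW _ WV2) ?mulr0 ?addr0// => i; exact: (sV i).1 || exact: (sV i).2.
Qed.

Definition locally_zero_cochains (T : topologicalType) n :
  lmodClosed (cochains R T n) := LmodClosed (@locally_zero_closed T n).

Lemma locally_zero_pull (T T' : topologicalType) (f : T -> T') n
    (phi : cochains R T' n) : continuous f ->
  phi \in locally_zero_cochains T' n ->
  cochain_pull f phi \in locally_zero_cochains T n.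
Proof.
move=> /continuousP fc /asboolP[U [Uo UT phiU]]; apply/asboolP.
exists [set f @^-1` V | V in U]; split.
- by move=> _ [V UV <-]; exact/fc/Uo.
- apply/seteqP; split=> // t _.
  have [V UV Vft] : (\bigcup_(V in U) V) (f t) by rewrite UT.
  by exists (f @^-1` V) => //; exists V.
- by move=> _ [V UV <-] s sV; exact: phiU sV.
Qed.

Lemma locally_zero_delta (T : topologicalType) n (phi : cochains R T n) :
  phi \in locally_zero_cochains T n ->
  cochain_delta phi \in locally_zero_cochains T n.+1.
Proof.
move=> /asboolP[U [Uo UT phiU]]; apply/asboolP; exists U; split=> // V UV s sV.
by rewrite /cochain_delta big1// => i _; rewrite (phiU V)// ?mulr0// => j; exact: sV.
Qed.

Definition cochain_cst T (a : R^o) : cochains R T 0 := fun=> a.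

HB.instance Definition _ T := GRing.isLinear.Build R R^o (cochains R T 0) *:%R
  (@cochain_cst T) (fun _ _ _ => erefl).

(* The degrees are shifted by one: degree 0 is the augmentation module R, and
   degree n.+1 is the module of Alexander-Spanier n-cochains. *)
Definition augAS_obj (T : topologicalType) n : lmodType R :=
  match n with
  | 0 => R^o
  | m.+1 => Quotient.quot (locally_zero_cochains T m)
  end.

Definition augAS_d (T : topologicalType) n :
    {linear augAS_obj T n -> augAS_obj T n.+1} :=
  match n with
  | 0 => quot_pi (locally_zero_cochains T 0) \o @cochain_cst T
  | m.+1 => quot_map (@cochain_delta R T m) (@locally_zero_delta T m)
  end.

Lemma augAS_dK (T : topologicalType) n x : augAS_d T n.+1 (augAS_d T n x) = 0.
Proof.
case: n x => [|n] x /=.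
  rewrite quot_map_pi; apply/eqP; rewrite -(linear0 (quot_pi _)) quot_piE subr0.
  apply/asboolP; exists [set setT]; split=> [V ->||V _ s _]; first exact: openT.
    exact: bigcup_set1.
  rewrite -[LHS]/(\sum_(i < 2) (-1) ^+ i * cochain_cst x (s \o lift i)).
  by rewrite big_ord_recl big_ord1 /cochain_cst mul1r mulN1r subrr.
rewrite -(quot_pi_repr x) !quot_map_pi [X in quot_pi _ X](_ : _ = 0) ?linear0//.
exact: cochain_deltaK.
Qed.

Definition augAS_complex (T : topologicalType) : cochain_complex R :=
  CochainComplex (@augAS_dK T).

Definition reducedAS (T : topologicalType) n : lmodType R :=
  cohomology (augAS_complex T) n.+1.

Section Pullback.
Variables (T T' : topologicalType) (f : T -> T') (fc : continuous f).

Definition augAS_pull n : {linear augAS_complex T' n -> augAS_complex T n} :=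
  match n with
  | 0 => idfun
  | m.+1 => quot_map (@cochain_pull R T T' f m)
              (fun phi => @locally_zero_pull T T' f m phi fc)
  end.

Lemma augAS_pullE n x :
  augAS_pull n.+1 (cochain_d (augAS_complex T') n x) =
  cochain_d (augAS_complex T) n (augAS_pull n x).
Proof.
case: n x => [|n] x /=; first by rewrite quot_map_pi.
by rewrite -(quot_pi_repr x) !quot_map_pi.
Qed.

Definition augAS_map : cochain_map (augAS_complex T') (augAS_complex T) :=
  CochainMap augAS_pullE.

Definition reducedAS_map n : {linear reducedAS T' n -> reducedAS T n} :=
  cohomology_map augAS_map n.+1.

End Pullback.

End AlexanderSpanier.

Section Complements.
Variables (K : realType) (R : pzRingType).

Definition subset_incl (T : Type) (A B : set T) (AB : A `<=` B) (x : A) : B :=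
  exist _ (val x) (mem_set (AB _ (set_mem (valP x)))).

Lemma subset_incl_continuous (T : topologicalType) (A B : set T) (AB : A `<=` B) :
  continuous (subset_incl AB : A -> B).
Proof.
apply: (@continuous_comp_initial B A T set_val (subset_incl AB)).
exact: (@initial_continuous A T set_val).
Qed.

Lemma subset_incl_id (T : Type) (A : set T) (AA : A `<=` A) n (phi : cochains R A n) :
  cochain_pull (subset_incl AA) phi = phi.
Proof.
apply/funext => s; congr phi; apply/funext => i; exact: val_inj.
Qed.

Lemma subset_incl_comp (T : Type) (A B C : set T) (AB : A `<=` B) (BC : B `<=` C)
    (AC : A `<=` C) n (phi : cochains R C n) :
  cochain_pull (subset_incl AB) (cochain_pull (subset_incl BC) phi) =
  cochain_pull (subset_incl AC) phi.
Proof.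
apply/funext => s; congr phi; apply/funext => i; exact: val_inj.
Qed.

Variables (X : metricType K) (A : set X) (n : nat).

Lemma setC_rnbhdS (r s : K) : r <= s -> ~` rnbhd s A `<=` ~` rnbhd r A.
Proof.
by move=> rs; apply: subsetC => x [a Aa ax]; exists a => //; exact: le_ball ax.
Qed.

Definition compl_restr (r s : K) (rs : r <= s) :
    {linear reducedAS R (~` rnbhd r A) n -> reducedAS R (~` rnbhd s A) n} :=
  reducedAS_map R (@subset_incl_continuous X _ _ (setC_rnbhdS rs)) n.

Lemma compl_restr_id r (h : r <= r) x : compl_restr h x = x.
Proof.
apply: cohomology_map_id => {}x /=; rewrite -(quot_pi_repr x) quot_map_pi.
by congr quot_pi; exact: subset_incl_id.
Qed.

Lemma compl_restr_comp r s t (rs : r <= s) (st : s <= t) (rt : r <= t) x :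
  compl_restr st (compl_restr rs x) = compl_restr rt x.
Proof.
apply: cohomology_map_comp => {}x /=; rewrite -(quot_pi_repr x).
move: (repr x) => z; apply: etrans (congr1 _ (quot_map_pi _ z)) _.
apply: etrans (quot_map_pi _ _) _; apply: etrans _ (esym (quot_map_pi _ z)).
by congr quot_pi; exact: subset_incl_comp.
Qed.

(* Reduced Alexander-Spanier cohomology of the complements of the
   r-neighborhoods of A, with the restriction maps. *)
Definition compl_system : direct_system K R :=
  DirectSystem (dsys_obj := fun r => reducedAS R (~` rnbhd r A) n)
    compl_restr_id compl_restr_comp.

End Complements.

(* Main.v *)
(* A cochain phi lies in CX^n(X - A) iff, for every r, it vanishes on the tuples
   of diameter at most r that are far enough from A. Let LZ^n be the cochains
   that are locally zero outside some N_s(A). As the complex of all cochains is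
   acyclic, the theorem says that CX and LZ have the same cohomology, i.e. that
   a cochain phi in LZ whose coboundary is in CX can be written
   phi = d eta + (element of CX) with eta in LZ.
   Locally this follows from the contractibility of balls: for a contraction
   H : [0, 1] x B -> D and a locally zero cocycle phi on D, summing phi over the
   prisms between B and its image under H(theta_1(y), y), then between
   H(theta_1(y), y) and H(theta_2(y), y), ..., gives a locally zero primitive on
   B, when theta_j(y) = min(1, j l(y) / 8) for a Lipschitz function l that is
   small with respect to the moduli of local vanishing of phi along H(-, y).
   The local primitives, indexed by tuples s of centers, are patched by the zigzag
   of a double complex of functions of (s; t), locally zero in t. It is exact in
   t by the local statement, and in s because of the contraction
   k(s; t) |-> k(c(t_0), s; t), where c : X -> X moves points by less than 1 and
   takes finitely many values near each point, so that it preserves local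
   vanishing. *)
From HB Require Import structures.
Require Import Defs.
From mathcomp Require Import all_boot all_order all_algebra.
From mathcomp Require Import wochoice interval_inference zify lra.
From mathcomp Require Import all_classical all_reals ereal topology normedtype.

Set Implicit Arguments.
Unset Strict Implicit.
Unset Printing Implicit Defensive.

Import Order.TTheory GRing.Theory Num.Theory.
Import numFieldNormedType.Exports.

Local Open Scope classical_set_scope.
Local Open Scope ring_scope.

(** * Cochains on lists *)

Section ListCochains.
Variable V : zmodType.
Implicit Type X : eqType.

Fixpoint delta X (phi : seq X -> V) (s : seq X) : V :=
  if s is x :: s' then phi s' - delta (fun u => phi (x :: u)) s' else 0.

Lemma eq_delta X (phi psi : seq X -> V) s :
  (forall u, (size u).+1 = size s -> {subset u <= s} -> phi u = psi u) ->
  delta phi s = delta psi s.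
Proof.
elim: s phi psi => [//|x s IH] phi psi e /=; congr (_ - _).
  by apply: e => // y ys; rewrite inE ys orbT.
apply: IH => u us uS; apply: e => [|y]; first by rewrite /= us.
by rewrite !inE => /orP[->//|/uS ->]; rewrite orbT.
Qed.

Lemma delta0 X (s : seq X) : delta (fun=> 0) s = 0.
Proof. by elim: s => [//|x s IH] /=; rewrite IH subr0. Qed.

Lemma delta_eq0 X (phi : seq X -> V) s :
  (forall u, (size u).+1 = size s -> {subset u <= s} -> phi u = 0) ->
  delta phi s = 0.
Proof. by move=> phi0; rewrite -(delta0 s); apply: eq_delta. Qed.

Lemma deltaB X (phi psi : seq X -> V) s :
  delta (fun u => phi u - psi u) s = delta phi s - delta psi s.
Proof.
elim: s phi psi => [|x s IH] phi psi /=; first by rewrite subr0.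
by rewrite IH !opprB addrACA [RHS]addrACA; congr (_ + _); rewrite addrC.
Qed.

Lemma delta_sum X (I : Type) (r : seq I) (P : pred I) (phi : I -> seq X -> V) s :
  delta (fun u => \sum_(i <- r | P i) phi i u) s =
  \sum_(i <- r | P i) delta (phi i) s.
Proof.
elim: s phi => [|x s IH] phi /=; first by rewrite big1.
by rewrite (IH (fun i u => phi i (x :: u))) -sumrB.
Qed.

Lemma deltaK X (phi : seq X -> V) s : delta (delta phi) s = 0.
Proof.
elim: s phi => [//|x s IH] phi /=.
by rewrite deltaB IH subr0 subrr.
Qed.

Lemma delta_comm (X Y : eqType) (phi : seq X -> seq Y -> V) s t :
  delta (fun u => delta (phi u) t) s = delta (fun v => delta (phi^~ v) s) t.
Proof.
elim: s phi => [|x s IH] phi /=; first by rewrite delta0.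
by rewrite deltaB (IH (fun u => phi (x :: u))).
Qed.

Lemma delta_map (X Y : eqType) (h : X -> Y) (phi : seq Y -> V) s :
  delta (fun u => phi (map h u)) s = delta phi (map h s).
Proof. by elim: s phi => [//|x s IH] phi /=; rewrite (IH (fun u => phi (h x :: u))). Qed.

Section Prism.
Variables (X Y : eqType) (f g : X -> Y).

Fixpoint prism (phi : seq Y -> V) (s : seq X) : V :=
  if s is x :: s' then
    phi [:: f x, g x & map g s'] - prism (fun u => phi (f x :: u)) s'
  else 0.

Lemma prism_eq0 phi s :
  (forall u, {subset u <= map f s ++ map g s} -> phi u = 0) -> prism phi s = 0.
Proof.
elim: s phi => [//|x s IH] phi phi0 /=; rewrite phi0 ?IH ?subr0//.
  move=> u us; apply: phi0 => y; rewrite inE => /orP[/eqP->|/us].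
    by rewrite inE eqxx.
  by rewrite !mem_cat /= !inE => /orP[->|->]; rewrite !orbT.
by move=> y; rewrite !inE mem_cat inE => /or3P[->|->|->]; rewrite ?orbT.
Qed.

Lemma prismB phi psi s :
  prism (fun u => phi u - psi u) s = prism phi s - prism psi s.
Proof.
elim: s phi psi => [|x s IH] phi psi /=; first by rewrite subr0.
by rewrite IH !opprB addrACA [RHS]addrACA; congr (_ + _); rewrite addrC.
Qed.

Lemma prism_delta phi s :
  delta (prism phi) s + prism (delta phi) s = phi (map g s) - phi (map f s).
Proof.
elim: s phi => [|x s IH] phi /=; first by rewrite addr0 subrr.
rewrite deltaB prismB (delta_map g (fun u => phi [:: f x, g x & u])).
have := IH (fun u => phi (f x :: u)).
set a := prism phi s; set b := delta _ (map g s); set c := delta _ s.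
set d := prism (delta _) s => e; rewrite !opprB !addrA.
rewrite [LHS](ACl ((1*8)*(3*5)*4*((2*7)*6)))/= subrr addNr !add0r e.
by rewrite addrAC subrr add0r.
Qed.

End Prism.

End ListCochains.


Section TuplesAsLists.
Variables (R : pzRingType) (X : eqType).

Definition vertices n (s : 'I_n -> X) : seq X := [seq s i | i <- enum 'I_n].

Definition list_cochain n (phi : cochains R X n) (s : seq X) : R :=
  if s is x :: _ then
    if size s == n.+1 then phi (fun i => nth x s i) else 0
  else 0.

Definition cochain_of_list n (phi : seq X -> R) : cochains R X n :=
  fun s => phi (vertices s).

Lemma size_vertices n (s : 'I_n -> X) : size (vertices s) = n.
Proof. by rewrite size_map size_enum_ord. Qed.

Lemma mem_verticesP n (s : 'I_n -> X) x :
  reflect (exists i, x = s i) (x \in vertices s).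
Proof.
apply: (iffP mapP) => [[i _ ->]|[i ->]]; first by exists i.
by exists i; rewrite ?mem_enum.
Qed.

Lemma nth_vertices n (s : 'I_n -> X) x (i : 'I_n) : nth x (vertices s) i = s i.
Proof. by rewrite (nth_map i) ?size_enum_ord// nth_ord_enum. Qed.

Lemma vertices_recl n (s : 'I_n.+1 -> X) :
  vertices s = s ord0 :: vertices (s \o lift ord0).
Proof. by rewrite /vertices enum_ordSl /= -map_comp. Qed.

Lemma vertices_nth n x (s : seq X) :
  size s = n -> vertices (fun i : 'I_n => nth x s i) = s.
Proof.
move=> sn; apply: (@eq_from_nth _ x); rewrite size_vertices// => i ni.
by rewrite (nth_vertices _ _ (Ordinal ni)).
Qed.

Lemma list_cochain_vertices n (phi : cochains R X n) (s : 'I_n.+1 -> X) :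
  list_cochain phi (vertices s) = phi s.
Proof.
rewrite /list_cochain vertices_recl -vertices_recl size_vertices eqxx.
by congr phi; apply/funext => i; rewrite nth_vertices.
Qed.

Lemma list_cochain_size n (phi : cochains R X n) s :
  size s != n.+1 -> list_cochain phi s = 0.
Proof. by case: s => [//|x s] /negPf /= ->. Qed.

Lemma list_cochainE n (phi : cochains R X n) s : size s = n.+1 ->
  exists2 t : 'I_n.+1 -> X, vertices t = s & list_cochain phi s = phi t.
Proof.
case: s => [//|x s] sn; exists (fun i => nth x (x :: s) i).
  exact: vertices_nth.
by rewrite -[in LHS](vertices_nth x sn) list_cochain_vertices.
Qed.

Lemma delta_vertices n (phi : seq X -> R) (s : 'I_n.+1 -> X) :
  delta phi (vertices s) =
  \sum_(i < n.+1) (-1) ^+ i * phi (vertices (s \o lift i)).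
Proof.
elim: n phi s => [|n IH] phi s; rewrite vertices_recl /=.
  rewrite big_ord1 mul1r (size0nil (size_vertices (s \o lift ord0))) /=.
  by rewrite subr0.
rewrite IH [RHS]big_ord_recl mul1r; congr (_ + _); rewrite -sumrN.
apply: eq_bigr => i _; rewrite -mulNr -mulN1r -exprS; congr (_ * phi _).
rewrite [RHS]vertices_recl; congr (_ :: _).
  by congr s; apply: val_inj.
congr vertices; apply/funext => j /=; congr s; apply: val_inj => /=.
by rewrite /bump /=; lia.
Qed.

Lemma cochain_delta_list n (phi : cochains R X n) (s : 'I_n.+2 -> X) :
  cochain_delta phi s = delta (list_cochain phi) (vertices s).
Proof.
rewrite delta_vertices; apply: eq_bigr => i _.
by rewrite list_cochain_vertices.
Qed.

Lemma cochain_of_list_delta n (phi : seq X -> R) :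
  cochain_delta (@cochain_of_list n phi) = cochain_of_list (delta phi).
Proof. by apply/funext => s; rewrite /cochain_of_list delta_vertices. Qed.

End TuplesAsLists.

(** * Primitives of locally zero cocycles *)

Section LocallyZero.
Variables (K : realType) (X : metricType K) (V : zmodType).
Implicit Types (B D : set X) (phi : seq X -> V).

Definition in_ball (y : X) (e : K) (s : seq X) := forall z, z \in s -> mdist y z < e.

Lemma in_ball_sub y e s t : {subset s <= t} -> in_ball y e t -> in_ball y e s.
Proof. by move=> st te z /st /te. Qed.

Lemma in_ball_le y e e' s : e <= e' -> in_ball y e s -> in_ball y e' s.
Proof. by move=> ee' se z /se /lt_le_trans; apply. Qed.

Lemma in_ball_shift y y' e e' s : mdist y' y + e <= e' -> in_ball y e s ->
  in_ball y' e' s.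
Proof.
move=> ee' se z /se yz; apply: lt_le_trans ee'.
by rewrite (le_lt_trans (metric_triangle _ y _))// ltrD2l.
Qed.

Definition zero_near phi (y : X) :=
  exists2 e : K, 0 < e & forall s, in_ball y e s -> phi s = 0.

Lemma zero_near_nseq phi y s : zero_near phi y -> (forall z, z \in s -> z = y) -> phi s = 0.
Proof. by move=> [e e0 phie] sy; apply: phie => z /sy ->; rewrite mdistxx. Qed.

Lemma zero_nearB phi psi y : zero_near phi y -> zero_near psi y ->
  zero_near (fun s => phi s - psi s) y.
Proof.
move=> [e e0 phie] [e' e'0 psie]; exists (Num.min e e'); first by rewrite lt_min e0.
move=> s se; rewrite phie ?psie ?subrr//; apply: in_ball_le se.
  by rewrite ge_min lexx orbT.
by rewrite ge_min lexx.
Qed.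

Lemma zero_near_delta phi y : zero_near phi y -> zero_near (delta phi) y.
Proof.
move=> [e e0 phie]; exists e => // s se; apply: delta_eq0 => u _ us.
by apply: phie; apply: in_ball_sub se.
Qed.

Section Contraction.
Variables (B D : set X) (c : X) (H : K * X -> X) (phi : seq X -> V).
Hypothesis Hcont : {within `[0, 1] `*` B, continuous H}.
Hypothesis HD : forall t x, t \in `[0, 1] -> B x -> D (H (t, x)).
Hypothesis H0 : forall x, B x -> H (0, x) = x.
Hypothesis H1 : forall x, B x -> H (1, x) = c.
Hypothesis Dc : D c.
Hypothesis phiD : forall y, D y -> zero_near phi y.
Hypothesis dphi : forall s, (forall z, z \in s -> D z) -> delta phi s = 0.

Let good (y : X) (e : K) := forall t : K, t \in `[0, 1] -> forall s : seq X,
  (forall z, z \in s -> exists t' y', [/\ t' \in `[0, 1], `|t - t'| < e,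
     B y', mdist y y' < e & z = H (t', y')]) -> phi s = 0.

Let good_le y e e' : e <= e' -> good y e' -> good y e.
Proof.
move=> ee' g t t01 s sH; apply: (g t t01) => z /sH[t' [y' [? tt' ? yy' ?]]].
by exists t', y'; split=> //; apply: lt_le_trans ee'.
Qed.

Let good_shift y y' e : good y e -> good y' (e - mdist y y').
Proof.
move=> g t t01 s sH; apply: (g t t01) => z /sH[t' [y1 [? tt' ? yy1 ?]]].
exists t', y1; split=> //.
  by apply: lt_le_trans tt' _; rewrite lerBlDr lerDl mdist_ge0.
by rewrite (le_lt_trans (metric_triangle _ y' _))// addrC -ltrBrDr.
Qed.

Let good_ex y : B y -> exists2 e, 0 < e & good y e.
Proof.
move=> By; have /compact_near_coveringP cov := @segment_compact K 0 1.
have : \forall e \near (0 : K)^'+, (`[0, 1] : set K) `<=` (fun t => forall s : seq X,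
  (forall z, z \in s -> exists t' y', [/\ t' \in `[0, 1], `|t - t'| < e,
     B y', mdist y y' < e & z = H (t', y')]) -> phi s = 0).
  apply: cov => t /= t01.
  have [e e0 phie] := phiD (HD t01 By).
  have /subspace_continuousP/(_ (t, y) (conj t01 By)) := Hcont.
  move=> /(_ _ (nbhsx_ballx _ _ e0)) /nbhs_ballP[d /= d0 Hd].
  exists (ball t (d / 2), [set e' | 0 < e' < d / 2]) => /=.
    split; first by apply: nbhsx_ballx; rewrite divr_gt0.
    exists (d / 2); first by rewrite /= divr_gt0.
    by move=> e' /=; rewrite sub0r normrN => /ltr_normlW e'd e'0; apply/andP.
  move=> [t1 e'] /= [tt1 /andP[e'0 e'd]] s sH; apply: phie => z /sH.
  move=> [t' [y' [t'01 tt' By' yy' ->]]].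
  suff : ball (H (t, y)) e (H (t', y')) by rewrite ballEmdist.
  apply: Hd => //; split; rewrite /=.
    rewrite /ball /= (splitr d) -(subrKA t1).
    by rewrite (le_lt_trans (ler_normD _ _))// ltrD// (lt_trans tt').
  by rewrite ballEmdist /= (lt_trans yy')// (lt_le_trans e'd)// ler_pdivrMr//; lra.
move=> [d /= d0 gd]; exists (d / 2); first by rewrite divr_gt0.
apply: gd; last by rewrite divr_gt0.
by rewrite /= sub0r normrN gtr0_norm ?divr_gt0// ltr_pdivrMr//; lra.
Qed.

(* A Lebesgue number of [0, 1] x {y}. *)
Let ell (y : X) := sup [set e | 0 < e <= 1 /\ good y e].

Let ell_sup y : B y -> has_sup [set e | 0 < e <= 1 /\ good y e].
Proof.
move=> By; split; last by exists 1 => e [/andP[]].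
have [e e0 ge] := good_ex By; exists (Num.min e 1); split.
  by rewrite lt_min e0 ltr01 ge_min lexx orbT.
by apply: good_le ge; rewrite ge_min lexx.
Qed.

Let ell_ub y e : B y -> 0 < e <= 1 -> good y e -> e <= ell y.
Proof. by move=> By e01 ge; apply: (sup_upper_bound (ell_sup By)). Qed.

Let ell_gt0 y : B y -> 0 < ell y.
Proof.
move=> By; have [[e [e01 ge]] _] := ell_sup By.
by rewrite (lt_le_trans _ (ell_ub By e01 ge))//; case/andP: e01.
Qed.

Let ell_good y e : B y -> e < ell y -> good y e.
Proof.
move=> By /(sup_gt (ell_sup By).1)[e' [_ ge'] /ltW ee'].
exact: good_le ge'.
Qed.

Let ell_lip y y' : B y -> B y' -> ell y <= ell y' + mdist y y'.
Proof.
move=> By By'; apply: sup_le_ub => [|e [/andP[e0 e1] ge]].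
  exact: (ell_sup By).1.
have [ey|ye] := leP e (mdist y y').
  by rewrite (le_trans ey)// lerDr ltW// ell_gt0.
rewrite -lerBlDr; apply: ell_ub => //; last exact: good_shift.
by rewrite subr_gt0 ye (le_trans _ e1)// gerBl mdist_ge0.
Qed.

Let theta j y : K := Num.min 1 (j%:R * ell y / 8).

Let theta_in j y : B y -> theta j y \in `[0, 1].
Proof.
move=> By; rewrite in_itv /= ge_min lexx le_min ler01 /=.
by rewrite divr_ge0// mulr_ge0// ltW// ell_gt0.
Qed.

Let f j y := H (theta j y, y).

Let f_in j y : B y -> D (f j y).
Proof. by move=> By; apply: HD => //; apply: theta_in. Qed.

Let f_start y : B y -> f 0%N y = y.
Proof. by move=> By; rewrite /f /theta !mul0r min_r ?ler01// H0. Qed.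

(* From this index on, f is constant at y; the sum defining lam is thus finite,
   and can be truncated anywhere later since phi vanishes on constant tuples. *)
Let arrival y := Num.bound (8 / ell y).

Let theta_end j y : B y -> (arrival y <= j)%N -> theta j y = 1.
Proof.
move=> By yj; have l0 := ell_gt0 By; rewrite /theta min_l//.
rewrite ler_pdivlMr// mul1r -ler_pdivrMr//.
have /archi_boundP/ltW/le_trans : 0 <= 8 / ell y by rewrite divr_ge0// ltW.
by apply; rewrite ler_nat.
Qed.

Let f_end j y : B y -> (arrival y <= j)%N -> f j y = c.
Proof. by move=> By yj; rewrite /f theta_end// H1. Qed.

Let theta_near y y' j : B y -> B y' ->
  mdist y y' <= ell y / 2 -> mdist y y' <= ell y / (Num.bound (16 / ell y)).+1%:R ->
  `|theta j y - theta j y'| <= ell y / 8.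
Proof.
move=> By By' yy'2 yy'; have l0 := ell_gt0 By; set J := (Num.bound _).+1 in yy'.
have l'l : ell y' <= ell y + mdist y y' by rewrite metric_sym ell_lip.
have ll' := ell_lip By By'.
have [jJ|/ltnW Jj] := leqP j J.
  have minL (a b : K) : `|Num.min 1 a - Num.min 1 b| <= `|a - b|.
    have := ler_norm (a - b); have := ler_norm (b - a); rewrite distrC ler_norml.
    by case: (leP 1 a) => ?; case: (leP 1 b) => ?; lra.
  apply: le_trans (minL _ _) _.
  rewrite -mulrBl -mulrBr !normrM normfV (ger0_norm (ler0n _ _)) (ger0_norm (ler0n _ 8)).
  rewrite ler_pM2r ?invr_gt0//.
  rewrite [leRHS](_ : _ = J%:R * (ell y / J%:R)); last first.
    by rewrite mulrCA divff ?mulr1// pnatr_eq0.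
  apply: ler_pM => //; first by rewrite ler_nat.
  apply: le_trans yy'; rewrite ler_norml; lra.
have J16 : 16 <= J%:R * ell y.
  rewrite -ler_pdivrMr//; have /archi_boundP/ltW/le_trans : 0 <= 16 / ell y.
    by rewrite divr_ge0// ltW.
  by apply; rewrite ler_nat.
have end1 z : ell y / 2 <= ell z -> theta j z = 1.
  move=> lz; rewrite /theta min_l//.
  have : J%:R * ell y <= j%:R * ell y by rewrite ler_pM2r// ler_nat.
  have : j%:R * (ell y / 2) <= j%:R * ell z by rewrite ler_wpM2l.
  by lra.
rewrite !end1 ?subrr ?normr0; lra.
Qed.

Let lam s := - \sum_(0 <= j < \max_(y <- s) arrival y) prism (f j) (f j.+1) phi s.

Let lamE J s : (forall z, z \in s -> B z) -> (\max_(y <- s) arrival y <= J)%N ->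
  lam s = - \sum_(0 <= j < J) prism (f j) (f j.+1) phi s.
Proof.
move=> sB sJ; congr (- _); rewrite [RHS](big_cat_nat _ sJ)//=.
rewrite [X in _ + X]big1_seq ?addr0// => j /andP[_]; rewrite mem_index_iota => /andP[js _].
have fc j' z : z \in s -> (j <= j')%N -> f j' z = c.
  move=> zs jj'; apply: f_end; first exact: sB.
  by apply: leq_trans jj'; apply: leq_trans js; apply: leq_bigmax_seq.
apply: prism_eq0 => u us; apply: (zero_near_nseq (phiD Dc)) => z /us.
rewrite mem_cat => /orP[] /mapP[z' z's ->]; exact: fc.
Qed.

Lemma contraction_primitive : exists2 lam : seq X -> V,
  forall y, B y -> exists2 e : K, 0 < e & forall s, in_ball y e s ->
    (forall z, z \in s -> B z) -> lam s = 0 &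
  forall s, (forall z, z \in s -> B z) -> delta lam s = phi s.
Proof.
exists lam => [y By|s sB].
  have l0 := ell_gt0 By; pose J : K := (Num.bound (16 / ell y)).+1%:R.
  exists (Num.min (ell y / 2) (ell y / J)).
    by rewrite lt_min !divr_gt0.
  move=> s se sB; rewrite /lam big1_seq ?oppr0// => j _.
  have yl2 z : z \in s -> mdist y z < ell y / 2 by move=> /se; rewrite lt_min => /andP[].
  have yJ z : z \in s -> mdist y z < ell y / J by move=> /se; rewrite lt_min => /andP[].
  have g : good y (ell y / 2) by apply: ell_good => //; lra.
  apply: prism_eq0 => u us; apply: (g _ (theta_in j By)) => z /us.
  rewrite mem_cat => /orP[] /mapP[z' z's ->].
    exists (theta j z'), z'; split => //; [exact/theta_in/sB| |exact: sB|exact: yl2].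
    apply: le_lt_trans (theta_near j By (sB _ z's) (ltW (yl2 _ z's)) (ltW (yJ _ z's))) _.
    lra.
  exists (theta j.+1 z'), z'; split => //; [exact/theta_in/sB| |exact: sB|exact: yl2].
  have := theta_near j By (sB _ z's) (ltW (yl2 _ z's)) (ltW (yJ _ z's)).
  have : `|theta j z' - theta j.+1 z'| <= ell z' / 8.
    rewrite /theta -[j.+1%:R]natr1 mulrDl mul1r mulrDl; have := ell_gt0 (sB _ z's) => lz'.
    set a := j%:R * _ / _; rewrite ler_norml.
    by case: (leP 1 a) => ?; case: (leP 1 (a + ell z' / 8)) => ?; lra.
  have : ell z' <= ell y + mdist y z' by rewrite metric_sym; apply: ell_lip => //; apply: sB.
  have := yl2 _ z's; have := ler_normD (theta j y - theta j z') (theta j z' - theta j.+1 z').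
  by rewrite subrKA; lra.
set J := (\max_(y <- s) arrival y)%N.
rewrite (@eq_delta _ _ _ (fun u => 0 - \sum_(0 <= j < J) prism (f j) (f j.+1) phi u)); last first.
  move=> u _ us; rewrite sub0r; apply: lamE => [z /us/sB//|].
  by apply/bigmax_leqP_seq => z /us zs _; apply: leq_bigmax_seq.
rewrite deltaB delta0 sub0r delta_sum.
under eq_bigr => j _.
  have := prism_delta (f j) (f j.+1) phi s.
  rewrite [prism _ _ (delta phi) _]prism_eq0 ?addr0 => [->|u us]; first over.
  apply: dphi => z /us; rewrite mem_cat => /orP[] /mapP[z' z's ->]; exact/f_in/sB.
rewrite (telescope_sumr (fun j => phi (map (f j) s)))// opprB.
rewrite [phi (map (f J) s)](zero_near_nseq (phiD Dc)) ?subr0; last first.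
  move=> z /mapP[z' z's ->]; apply: f_end; first exact: sB.
  exact: leq_bigmax_seq.
congr phi; rewrite -[RHS]map_id; apply/eq_in_map => z zs; apply: f_start; exact: sB.
Qed.

End Contraction.
End LocallyZero.

(** * Patching *)

Section LocallyFiniteMap.
Variables (K : realType) (X : metricType K).

Lemma well_order_choice : exists2 R : rel X, antisymmetric R &
  forall A : set X, A !=set0 -> exists2 z, A z & forall x, A x -> R z x.
Proof.
have [R Rwo] := well_ordering_principle X; exists R => [x y|A [a Aa]].
  exact: (wo_chain_antisymmetric (withinW Rwo) (x := x) (y := y)).
have [|z [[/asboolP Az zA] _]] := Rwo (fun x => `[< A x >]).
  by exists a; apply/asboolP.
by exists z => // x Ax; apply: zA; apply/asboolP.
Qed.

(* Let m(t, y) be the first point, for a well-order of X, at distance less than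
   t from y. As t increases to 1, m(t, y) is eventually constant, and so is it
   for all points close to y; the map sends y to m(t, y) for the first t in a
   sequence tending to 1 around which m(t, y) does not jump. *)
Lemma locally_finite_map : exists2 c : X -> X, (forall y, mdist y (c y) < 1) &
  forall y, exists2 e : K, 0 < e &
    exists vs : seq X, forall y', mdist y y' < e -> c y' \in vs.
Proof.
have [R Ranti Rmin] := well_order_choice.
have /choice[m mP] : forall ty : K * X, exists z, 0 < ty.1 ->
    mdist ty.2 z < ty.1 /\ forall x, mdist ty.2 x < ty.1 -> R z x.
  move=> [t y] /=; have [t0|t0] := boolP (0 < t); last by exists y.
  have [|z zt zR] := Rmin [set z | mdist y z < t]; last by exists z.
  by exists y; rewrite /= mdistxx.
pose u n : K := n.+3%:R^-1.
have u0 n : 0 < u n by rewrite invr_gt0.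
have u3 n : u n <= 3^-1 by rewrite lef_pV2 ?posrE// ler_nat.
pose stable n y := m (1 - 3 / 2 * u n, y) = m (1 - u n / 2, y).
have stableP y : exists n, forall y', mdist y y' < u n / 2 -> stable n y'.
  have [] := mP (1, y) ltr01 => /=; set z := m _ => yz zR.
  have : 0 < (1 - mdist y z) / 2 by rewrite divr_gt0// subr_gt0.
  set d := _ / 2 => d0; pose n := Num.bound d^-1; exists n => y' yy'.
  have ud : u n < d.
    rewrite -[ltRHS]invrK ltf_pV2 ?posrE ?invr_gt0//.
    have /archi_boundP : 0 <= d^-1 by rewrite invr_ge0 ltW.
    by move/lt_trans; apply; rewrite ltr_nat -/n; lia.
  have mz t : 1 - 3 / 2 * u n <= t <= 1 - u n / 2 -> m (t, y') = z.
    move=> /andP[t1 t2]; have [|y't tR] := mP (t, y').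
      by have := u0 n; have := u3 n => /=; lra.
    apply: Ranti; apply/andP; split.
      apply: tR => /=; apply: le_lt_trans (metric_triangle _ y _) _.
      rewrite metric_sym; have := u0 n; move: ud; rewrite /d; lra.
    apply: zR => /=; apply: le_lt_trans (metric_triangle _ y' _) _.
    by move: y't => /=; lra.
  by rewrite /stable !mz//; have := u0 n; have := u3 n; lra.
have ex_stable y : exists n, `[< stable n y >].
  have [n ny] := stableP y; exists n; apply/asboolP/ny.
  by rewrite mdistxx divr_gt0.
pose level y := ex_minn (ex_stable y).
have level_stable y : stable (level y) y.
  by rewrite /level; case: ex_minnP => n /asboolP.
pose c y := m (1 - u (level y), y).
have c_stable n y y' : stable n y -> mdist y y' < u n / 2 ->
    m (1 - u n, y') = m (1 - 3 / 2 * u n, y).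
  move=> ny yy'; have := u0 n; have := u3 n => u3n u0n.
  have [|] := mP (1 - u n, y'); rewrite /= ; first by lra.
  have [|] := mP (1 - 3 / 2 * u n, y); rewrite /= ; first by lra.
  have [|] := mP (1 - u n / 2, y); rewrite /= ; first by lra.
  move=> _ R1 d2 _ d3 R3; apply: Ranti; apply/andP; split.
    apply: R3; apply: le_lt_trans (metric_triangle _ y _) _.
    by rewrite metric_sym; lra.
  rewrite ny; apply: R1; apply: le_lt_trans (metric_triangle _ y' _) _.
  by lra.
exists c => [y|y].
  have [|d _] := mP (1 - u (level y), y); have := u0 (level y).
    by have := u3 (level y) => /=; lra.
  by move: d; rewrite /= /c; lra.
have [n0 n0y] := stableP y; exists (u n0 / 4); first by rewrite divr_gt0.
have /choice[v vP] : forall n, exists z, forall y', mdist y y' < u n0 / 4 ->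
    (n <= n0)%N -> level y' = n -> c y' = z.
  move=> n; have [[y1 [yy1 nn0 y1n]]|no] := pselect (exists y', [/\ mdist y y' < u n0 / 4,
    (n <= n0)%N & level y' = n]); last first.
    by exists y => y' yy' nn0 y'n; exfalso; apply: no; exists y'.
  exists (m (1 - 3 / 2 * u n, y1)) => y2 yy2 _ y2n; rewrite /c y2n; apply: c_stable.
    by rewrite -y1n.
  apply: le_lt_trans (metric_triangle _ y _) _; rewrite metric_sym.
  have : u n0 <= u n by rewrite lef_pV2 ?posrE// ler_nat.
  by lra.
exists [seq v n | n <- iota 0 n0.+1] => y' yy'.
have ln0 : (level y' <= n0)%N.
  rewrite /level; case: ex_minnP => n _; apply; apply/asboolP/n0y.
  by apply: lt_trans yy' _; have := u0 n0; lra.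
by rewrite (vP _ _ yy' ln0 erefl); apply: map_f; rewrite mem_iota.
Qed.

End LocallyFiniteMap.

Section FarAway.
Variables (K : realType) (X : metricType K) (A : set X) (V : zmodType).
Hypothesis A0 : A !=set0.

Definition far (s : K) (x : X) := forall a, A a -> s <= mdist a x.

Lemma farP s x : far s x <-> (~` rnbhd s A) x.
Proof.
split=> [fx [a Aa]|nx a Aa]; first by rewrite ballEmdist /= ltNge fx.
by rewrite leNgt; apply/negP => ax; apply: nx; exists a => //; rewrite ballEmdist.
Qed.

Lemma far_le s s' x : s' <= s -> far s x -> far s' x.
Proof. by move=> ss fx a /fx; apply: le_trans. Qed.

Lemma far_shift s r x y : mdist x y <= r -> far (s + r) x -> far s y.
Proof.
move=> xy fx a /fx ax; have := metric_triangle a y x; rewrite metric_sym in xy.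
by lra.
Qed.

Lemma far_mdist s b : exists s', forall x, far s' x -> s <= mdist b x.
Proof.
have [a Aa] := A0; exists (s + mdist a b) => x /(_ a Aa).
have := metric_triangle a b x; lra.
Qed.

Lemma contractible_ball (hX : unif_contractible_at_infinity X) r : 0 < r ->
  exists r' s, forall x, far s x -> exists2 D, contractible_inside (ball x r) D &
    forall y, D y -> mdist x y < r'.
Proof.
move=> r0; have [rho [mu [b [rho_le mu_le hc]]]] := hX.
have r20 : 0 <= 2 * r by rewrite mulr_ge0// ltW.
pose r2 : {nonneg K} := NngNum r20.
have [s far_b] := far_mdist ((mu r2)%:num + r) b.
exists ((rho r2)%:num + 1), s => x xs.
have [d dE dr] : exists2 d : {nonneg K}, diameter (ball x r) = (d%:num)%:E & d <= r2.
  have d0 : (0 <= diameter (ball x r))%E.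
    apply: ereal_sup_ubound; exists (x, x) => /=; last by rewrite mdistxx.
    by split; apply: ballxx.
  have d2 : (diameter (ball x r) <= (2 * r)%:E)%E.
    apply: ge_ereal_sup => _ [[y z] /= [xy xz] <-]; rewrite lee_fin.
    rewrite ballEmdist /= in xy; rewrite ballEmdist /= in xz.
    by have := metric_triangle y x z; rewrite [mdist y x]metric_sym; lra.
  have dfin : diameter (ball x r) \is a fin_num.
    by rewrite ge0_fin_numE// (le_lt_trans d2) ?ltry.
  have d0' : 0 <= fine (diameter (ball x r)) by rewrite fine_ge0.
  exists (NngNum d0') => /=; first by rewrite fineK.
  by rewrite -num_le /= -lee_fin fineK.
have [|D Ddiam BD] := hc d (ball x r) dE.
  apply: (@le_trans _ _ ((mu r2)%:num)%:E); first by rewrite lee_fin num_le mu_le.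
  apply: le_ereal_inf_tmp => _ [y /= xy <-].
  apply: le_ereal_inf_tmp => _ [e /= [e0 be] <-]; rewrite lee_fin.
  have := far_b x xs; rewrite ballEmdist /= in xy; rewrite ballEmdist /= in be.
  have := metric_triangle b y x; rewrite [mdist y x]metric_sym; lra.
exists D => // y Dy; have [DB _] := BD.
have Dx : D x by apply: DB; apply: ballxx.
apply: (@le_lt_trans _ _ ((rho r2)%:num)); last by rewrite ltrDl.
rewrite -lee_fin; apply: le_trans (_ : (rho d)%:num%:E <= _)%E; last first.
  by rewrite lee_fin num_le rho_le.
by apply: le_trans Ddiam; apply: ereal_sup_ubound; exists (x, y).
Qed.

Lemma ball_primitive (hX : unif_contractible_at_infinity X) r :
  exists r' s, forall x, far s x -> forall phi : seq X -> V,
    (forall y, mdist x y < r' -> zero_near phi y) ->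
    (forall t, in_ball x r' t -> delta phi t = 0) ->
  exists lam, (forall y, mdist x y < r -> zero_near lam y) /\
              (forall t, in_ball x r t -> delta lam t = phi t).
Proof.
have r0 : 0 < Num.max r 1 by rewrite lt_max ltr01 orbT.
have [r' [s hs]] := contractible_ball hX r0; exists r', s => x xs phi phi0 dphi.
have [D [BD [c Dc [H [Hc HD H0 H1]]]] Dr] := hs x xs.
have [//|y /Dr|t tD|lam lam0 dlam] := contraction_primitive (phi := phi) Hc HD H0 H1.
- exact: phi0.
- by apply: dphi => z /tD/Dr.
have rB y : mdist x y < r -> ball x (Num.max r 1) y.
  by rewrite ballEmdist /= lt_max => ->.
exists lam; split=> [y xy|t tr]; last by apply: dlam => z /tr/rB.
have [e e0 lame] := lam0 y (rB y xy).
exists (Num.min e (r - mdist x y)); first by rewrite lt_min e0 subr_gt0.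
move=> t te; apply: lame.
  by apply: in_ball_le te; rewrite ge_min lexx.
move=> z /te; rewrite lt_min => /andP[_ yz]; apply: rB.
by have := metric_triangle x y z; lra.
Qed.

End FarAway.

Section Bicomplex.
Variables (K : realType) (X : metricType K) (A : set X) (V : zmodType).
Hypothesis A0 : A !=set0.
Implicit Types (p : nat) (Q : pred nat) (f g k : seq X -> seq X -> V).

(* Functions of two tuples (s; t): vanish p Q means zero in degrees p, Q on all
   small tuples far from A; local p means locally zero in t, with a
   neighborhood depending on s. *)
Definition vanish p Q f := forall r : K, exists S : K, forall x, far A S x ->
  forall s t, size s = p -> Q (size t) -> in_ball x r s -> in_ball x r t -> f s t = 0.

Definition local p f := forall r : K, exists S : K, forall x, far A S x ->
  forall s, size s = p -> in_ball x r s -> forall y, mdist x y < r -> zero_near (f s) y.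

Lemma eq_vanish p Q f g : (forall s t, f s t = g s t) -> vanish p Q f -> vanish p Q g.
Proof.
move=> fg fv r; have [S hS] := fv r; exists S => x xS s t sp tQ sr tr.
by rewrite -fg; apply: (hS x).
Qed.

Lemma vanishB p Q f g : vanish p Q f -> vanish p Q g ->
  vanish p Q (fun s t => f s t - g s t).
Proof.
move=> fv gv r; have [S hS] := fv r; have [S' hS'] := gv r.
exists (Num.max S S') => x xS s t sp tQ sr tr.
rewrite (hS x) ?(hS' x) ?subrr//; apply: far_le xS.
  by rewrite le_max lexx orbT.
by rewrite le_max lexx.
Qed.

Lemma vanishD p Q f g : vanish p Q f -> vanish p Q g ->
  vanish p Q (fun s t => f s t + g s t).
Proof.
move=> fv gv; have zv : vanish p Q (fun _ _ => 0) by move=> r; exists 0.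
apply: eq_vanish (vanishB fv (vanishB zv gv)) => s t.
by rewrite sub0r opprK.
Qed.

Lemma vanish_sub p (Q Q' : pred nat) f :
  (forall n, Q' n -> Q n) -> vanish p Q f -> vanish p Q' f.
Proof.
by move=> QQ fv r; have [S hS] := fv r; exists S => x xS s t sp /QQ; apply: hS xS _ _ sp.
Qed.

Lemma vanish_deltar p (Q Q' : pred nat) f :
  (forall n, Q' n.+1 -> Q n) -> vanish p Q f -> vanish p Q' (fun s => delta (f s)).
Proof.
move=> QQ fv r; have [S hS] := fv r; exists S => x xS s t sp tQ sr tr.
apply: delta_eq0 => u ut us; apply: (hS x) => //; last exact: in_ball_sub tr.
by apply: QQ; rewrite ut.
Qed.

Lemma vanish_deltal p Q f :
  vanish p Q f -> vanish p.+1 Q (fun s t => delta (f^~ t) s).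
Proof.
move=> fv r; have [S hS] := fv r; exists S => x xS s t sp tQ sr tr.
apply: delta_eq0 => u us uS; apply: (hS x) => //; last exact: in_ball_sub sr.
by move: us; rewrite sp => -[].
Qed.

Lemma localB p f g : local p f -> local p g -> local p (fun s t => f s t - g s t).
Proof.
move=> fl gl r; have [S hS] := fl r; have [S' hS'] := gl r.
exists (Num.max S S') => x xS s sp sr y xy; apply: zero_nearB.
  by apply: (hS x) => //; apply: far_le xS; rewrite le_max lexx.
by apply: (hS' x) => //; apply: far_le xS; rewrite le_max lexx orbT.
Qed.

Lemma local_deltar p f : local p f -> local p (fun s => delta (f s)).
Proof.
move=> fl r; have [S hS] := fl r; exists S => x xS s sp sr y xy.
by apply: zero_near_delta; apply: (hS x).
Qed.

Lemma zero_near_deltal f (s : seq X) (y : X) :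
  (forall u, (size u).+1 = size s -> {subset u <= s} -> zero_near (f u) y) ->
  zero_near (fun t => delta (f^~ t) s) y.
Proof.
elim: s f => [|x s IH] f f0 /=; first by exists 1.
apply: zero_nearB; first by apply: f0 => // z zs; rewrite inE zs orbT.
apply: (IH (fun u => f (x :: u))) => u us uS; apply: f0; first by rewrite /= us.
by move=> z; rewrite !inE => /orP[->//|/uS ->]; rewrite orbT.
Qed.

Lemma local_deltal p f : local p f -> local p.+1 (fun s t => delta (f^~ t) s).
Proof.
move=> fl r; have [S hS] := fl r; exists S => x xS s sp sr y xy.
apply: zero_near_deltal => u us uS; apply: (hS x) => //; last exact: in_ball_sub sr.
by move: us; rewrite sp => -[].
Qed.

Lemma local_nil p f : local p.+1 f -> vanish p.+1 (leq^~ 0) f.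
Proof.
move=> fl r; have [S hS] := fl r; exists S => x xS [//|z s] t sp.
rewrite leqn0 => /nilP -> sr _.
have xz : mdist x z < r by apply: sr; rewrite inE eqxx.
have [e e0 fe] := hS x xS _ sp sr z xz.
exact: fe.
Qed.

Section Columns.
Hypothesis hX : unif_contractible_at_infinity X.

(* One g serves all radii: a tuple at distance d from A only has to handle the
   radii at most d, hence finitely many integers, and the largest one for which
   a primitive exists takes care of the smaller ones. *)
Lemma column_exact p f : local p.+1 f -> vanish p.+1 predT (fun s => delta (f s)) ->
  exists2 g, local p.+1 g & vanish p.+1 predT (fun s t => delta (g s) t - f s t).
Proof.
move=> fl fv; have [a0 Aa0] := A0.
pose P (N : nat) x s (lam : seq X -> V) :=
  (forall y, mdist x y < N%:R -> zero_near lam y) /\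
  (forall t, in_ball x N%:R t -> delta lam t = f s t).
have exP N : exists S : K, forall x s, far A S x -> size s = p.+1 ->
    in_ball x N%:R s -> exists lam, P N x s lam.
  have [r' [S1 h1]] := ball_primitive V A0 hX N%:R.
  have [S2 h2] := fl (Num.max r' N%:R); have [S3 h3] := fv (Num.max r' N%:R).
  exists (Num.max S1 (Num.max S2 S3)) => x s xS sp sN.
  have sm : in_ball x (Num.max r' N%:R) s.
    by apply: in_ball_le sN; rewrite le_max lexx orbT.
  apply: (h1 x).
  - by apply: far_le xS; rewrite le_max lexx.
  - move=> y xy; apply: (h2 x) => //; last by rewrite lt_max xy.
    by apply: far_le xS; rewrite !le_max lexx orbT.
  - move=> t tr; apply: (h3 x) => //.
      by apply: far_le xS; rewrite !le_max lexx !orbT.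
    by apply: in_ball_le tr; rewrite le_max lexx.
have P_le M N x s lam : (M <= N)%N -> P N x s lam -> P M x s lam.
  rewrite -(ler_nat K) => MN [lam0 dlam]; split=> [y xy|t tM].
    by apply: lam0; apply: lt_le_trans xy MN.
  by apply: dlam; apply: in_ball_le tM.
have /choice[g gP] : forall s, exists lam, if s is x :: _ then
    forall N : nat, N%:R <= mdist a0 x -> (exists lam', P N x s lam') -> P N x s lam
    else True.
  move=> [|x s]; first by exists (fun=> 0).
  pose B N := `[< N%:R <= mdist a0 x /\ exists lam', P N x (x :: s) lam' >].
  have [exB|noB] := pselect (exists N, B N); last first.
    by exists (fun=> 0) => N Nx PN; exfalso; apply: noB; exists N; apply/asboolP.
  have ubB N : B N -> (N <= Num.bound (mdist a0 x))%N.
    move=> /asboolP[Nx _]; rewrite -(ler_nat K) (le_trans Nx)// ltW//.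
    by apply: archi_boundP; apply: mdist_ge0.
  have [N /asboolP[_ [lam Plam]] maxN] := ex_maxnP exB ubB.
  exists lam => M Mx PM; apply: P_le Plam; apply: maxN; exact/asboolP.
have key r : exists S : K, forall x, far A S x -> forall s, size s = p.+1 ->
    in_ball x r s -> exists x1 (N : nat), [/\ mdist x x1 < r, 2 * r <= N%:R & P N x1 s (g s)].
  pose N := Num.bound (2 * r); have [S hS] := exP N.
  exists (Num.max S N%:R + r) => x xS [//|x1 s] sp sr.
  have xx1 : mdist x x1 < r by apply: sr; rewrite inE eqxx.
  have r0 : 0 < r by apply: le_lt_trans xx1; apply: mdist_ge0.
  have rN : 2 * r <= N%:R by rewrite ltW// archi_boundP// mulr_ge0// ltW.
  have x1S := far_shift (ltW xx1) xS.
  exists x1, N; split=> //; apply: (gP (x1 :: s)).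
    by apply: le_trans (x1S _ Aa0); rewrite le_max lexx orbT.
  apply: hS => //; first by apply: far_le x1S; rewrite le_max lexx.
  by apply: in_ball_shift sr; rewrite metric_sym; lra.
exists g => r; have [S hS] := key r; exists S => x xS s.
  move=> sp sr y xy; have [x1 [N [xx1 rN [g0 _]]]] := hS x xS s sp sr.
  by apply: g0; have := metric_triangle x1 x y; rewrite [mdist x1 x]metric_sym; lra.
move=> t sp _ sr tr; have [x1 [N [xx1 rN [_ dg]]]] := hS x xS s sp sr.
by rewrite dg ?subrr//; apply: in_ball_shift tr; rewrite metric_sym; lra.
Qed.

End Columns.

Lemma zero_near_seq (I : eqType) (F : I -> seq X -> V) (P : I -> Prop) (y : X) (vs : seq I) :
  (forall v, P v -> zero_near (F v) y) ->
  exists2 e : K, 0 < e & forall v, v \in vs -> P v -> forall s, in_ball y e s -> F v s = 0.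
Proof.
move=> F0; elim: vs => [|v vs [e e0 IH]]; first by exists 1.
have [/F0[e' e'0 Fe']|nPv] := pselect (P v); last first.
  exists e => // w; rewrite inE => /orP[/eqP->//|]; exact: IH.
exists (Num.min e e'); first by rewrite lt_min e0.
move=> w; rewrite inE => /orP[/eqP-> _ s se|wvs Pw s se].
  by apply: Fe'; apply: in_ball_le se; rewrite ge_min lexx orbT.
by apply: (IH w) => //; apply: in_ball_le se; rewrite ge_min lexx.
Qed.

Section Rows.
Variable c : X -> X.
Hypothesis c1 : forall y, mdist y (c y) < 1.
Hypothesis cfin : forall y, exists2 e : K, 0 < e &
  exists vs : seq X, forall y', mdist y y' < e -> c y' \in vs.

Definition cone k (s t : seq X) : V := if t is y :: _ then k (c y :: s) t else 0.

Lemma cone_local p k : local p.+1 k -> local p (cone k).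
Proof.
move=> kl r; have [S hS] := kl (r + 1); exists S => x xS s sp sr y xy.
have [e e0 [vs vsP]] := cfin y.
have [|e' e'0 he'] := @zero_near_seq _ (fun v => k (v :: s)) (fun v => mdist x v < r + 1) y vs.
  move=> v xv; apply: (hS x) => //; last by lra.
    by rewrite /= sp.
  by move=> z; rewrite inE => /orP[/eqP->//|/sr]; lra.
exists (Num.min (Num.min e e') (r - mdist x y)).
  by rewrite !lt_min e0 e'0 subr_gt0.
move=> [//|z t] te; have := te z; rewrite inE eqxx !lt_min => /(_ isT).
move=> /andP[/andP[ze ze'] yz] /=; apply: (he' (c z)); first exact: vsP.
  have := c1 z; have := metric_triangle x y z; have := metric_triangle x z (c z); lra.
by apply: in_ball_le te; rewrite !ge_min lexx orbT.
Qed.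

Lemma row_exact p Q k : local p.+1 k -> vanish p.+2 Q (fun s t => delta (k^~ t) s) ->
  vanish p.+1 Q (fun s t => delta (cone k ^~ t) s - k s t).
Proof.
move=> kl kv r; have [S hS] := kv (r + 1); have [S' hS'] := local_nil kl r.
exists (Num.max S S') => x xS s [|y t] sp tQ sr tr.
  rewrite (hS' x) ?subr0//; last by apply: far_le xS; rewrite le_max lexx orbT.
  by rewrite /= delta0.
have xc : mdist x (c y) < r + 1.
  have := metric_triangle x y (c y); have := c1 y.
  by have := tr y; rewrite inE eqxx => /(_ isT); lra.
have r1 : r <= r + 1 by lra.
have := hS x _ (c y :: s) (y :: t); rewrite /= sp => h.
apply/eqP; rewrite -oppr_eq0 opprB; apply/eqP; apply: h => //.
- by apply: far_le xS; rewrite le_max lexx.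
- by move=> z; rewrite inE => /orP[/eqP->//|/sr zr]; apply: lt_le_trans r1.
- exact: in_ball_le tr.
Qed.

Lemma zigzag (hX : unif_contractible_at_infinity X) q p f : local p.+1 f ->
    vanish p.+1 predT (fun s => delta (f s)) ->
    vanish p.+2 predT (fun s t => delta (f^~ t) s) ->
  exists g, [/\ local p.+1 g,
    vanish p.+1 predT (fun s t => delta (g s) t - f s t) &
    vanish p.+2 (leq^~ q) (fun s t => delta (g^~ t) s)].
Proof.
elim: q p f => [|q IH] p f fl fr fc; have [g0 g0l g0f] := column_exact hX fl fr.
  by exists g0; split=> //; apply: vanish_deltal; apply: local_nil.
have [k [kl kg0 kc]] : exists k, [/\ local p.+2 k,
    vanish p.+2 predT (fun s t => delta (k s) t - delta (g0^~ t) s) &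
    vanish p.+3 (leq^~ q) (fun s t => delta (k^~ t) s)].
  apply: IH; first exact: local_deltal.
    apply: eq_vanish (vanishD (vanish_deltal g0f) fc) => s t.
    by rewrite deltaB subrK delta_comm.
  by move=> r; exists 0 => *; apply: deltaK.
exists (fun s t => g0 s t - delta (cone k s) t); split.
- by apply: localB => //; apply: local_deltar; apply: cone_local.
- apply: eq_vanish g0f => s t.
  by rewrite deltaB deltaK subr0.
- have hk := vanish_deltar (Q' := leq^~ q.+1) (fun n h => h) (row_exact kl kc).
  apply: eq_vanish (vanishB (vanishB (f := fun _ _ => 0) _ hk) (vanish_sub _ kg0)) => //.
    by move=> s t; rewrite !deltaB delta_comm sub0r !opprB addrC subrKA.
  by move=> r; exists 0.
Qed.

End Rows.

Lemma far_primitive (hX : unif_contractible_at_infinity X) (phi : seq X -> V) q :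
    (exists S : K, forall x, far A S x -> zero_near phi x) ->
    (forall r : K, exists S : K, forall x, far A S x -> forall t, in_ball x r t ->
      delta phi t = 0) ->
  exists eta : seq X -> V,
    (exists S : K, forall x, far A S x -> exists2 e, 0 < e & forall t, in_ball x e t ->
      (size t <= q)%N -> eta t = 0) /\
    (forall r : K, exists S : K, forall x, far A S x -> forall t, in_ball x r t ->
      (size t <= q.+1)%N -> delta eta t = phi t).
Proof.
move=> [S0 phi0] dphi; have [c c1 cfin] := locally_finite_map X.
have [|||g [gl gphi gc]] := zigzag c1 cfin hX q (f := fun _ => phi) (p := 0%N).
- move=> r; exists (S0 + r) => x xS s _ _ y xy.
  by apply: phi0; apply: far_shift xS; apply: ltW.
- by move=> r; have [S hS] := dphi r; exists S => x xS s t _ _ _; apply: hS.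
- by move=> r; exists 0 => x _ [//|y [//|z [|//]]] t _ _ _ _ /=; rewrite subr0 subrr.
have g_const r : exists S : K, forall x, far A S x -> forall y z t,
    mdist x y < r -> mdist x z < r -> in_ball x r t -> (size t <= q)%N ->
    g [:: z] t = g [:: y] t.
  have [S hS] := gc r; exists S => x xS y z t xy xz tr tq.
  apply/eqP; rewrite -subr_eq0 -[X in _ - X]subr0; apply/eqP.
  apply: (hS x xS [:: y; z] t) => // w; rewrite !inE => /orP[]/eqP->//.
have g_nil r : exists S : K, forall x, far A S x -> forall y,
    mdist x y < r -> g [:: y] [::] = 0.
  have [S hS] := local_nil gl r; exists S => x xS y xy.
  by apply: (hS x) => // z; rewrite inE => /eqP->.
exists (fun t => if t is y :: _ then g [:: y] t else 0); split.
  have [S1 h1] := gl 1; have [S2 h2] := g_const 1.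
  exists (Num.max S1 S2) => x xS.
  have xx : mdist x x < 1 by rewrite mdistxx.
  have xS1 : far A S1 x by apply: far_le xS; rewrite le_max lexx.
  have xx1 : in_ball x 1 [:: x] by move=> z; rewrite inE => /eqP->.
  have [e e0 ge] := h1 x xS1 [:: x] erefl xx1 x xx.
  exists (Num.min e 1); first by rewrite lt_min e0 ltr01.
  move=> [//|y t] te tq.
  have xS2 : far A S2 x by apply: far_le xS; rewrite le_max lexx orbT.
  have te1 : in_ball x 1 (y :: t) by apply: in_ball_le te; rewrite ge_min lexx orbT.
  have xy1 : mdist x y < 1 by apply: te1; rewrite inE eqxx.
  rewrite (h2 x xS2 x y _ xx xy1 te1 tq).
  by apply: ge; apply: in_ball_le te; rewrite ge_min lexx.
move=> r; have [S1 h1] := g_const r; have [S2 h2] := g_nil r; have [S3 h3] := gphi r.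
have [S4 h4] : exists S : K, forall x, far A S x -> phi [::] = 0.
  by exists S0 => x /phi0[e e0]; apply.
exists (Num.max (Num.max S1 S4) (Num.max S2 S3)) => x xS [|y t] tr tq.
  by rewrite (h4 x)//; apply: far_le xS; rewrite !le_max lexx orbT.
have xy : mdist x y < r by apply: tr; rewrite inE eqxx.
have xt : in_ball x r t by apply: in_ball_sub tr => z zt; rewrite inE zt orbT.
have xS3 : far A S3 x by apply: far_le xS; rewrite !le_max lexx !orbT.
have ry : in_ball x r [:: y] by move=> z; rewrite inE => /eqP->.
apply/eqP; rewrite -subr_eq0; apply/eqP.
apply: etrans (h3 x xS3 [:: y] (y :: t) erefl isT ry tr); rewrite /=.
congr (_ - _ - _); case: t {tr} tq xt => [|z t] tq xt.
  apply/esym/(h2 x) => //; apply: far_le xS; rewrite !le_max lexx !orbT//.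
apply: (h1 x) => //; first by apply: far_le xS; rewrite !le_max lexx.
by apply: xt; rewrite inE eqxx.
Qed.

End Bicomplex.

Lemma cochain_deltaB (R : pzRingType) T n (phi psi : cochains R T n) :
  cochain_delta (phi - psi) = cochain_delta phi - cochain_delta psi.
Proof. exact: linearB. Qed.

(** * Comparison with the complements *)

Section CochainsFarAway.
Variables (K : realType) (X : metricType K) (R : pzRingType) (A : set X).
Hypothesis A0 : A !=set0.

Definition tuple_in_ball (x : X) (r : K) n (s : 'I_n -> X) := forall i, mdist x (s i) < r.

Definition germ_zero n (phi : cochains R X n) (x : X) :=
  exists2 e : K, 0 < e & forall s, tuple_in_ball x e s -> phi s = 0.

Definition coarsely_zero n (phi : cochains R X n) :=
  forall r : K, exists S : K, forall x, far A S x -> forall s, tuple_in_ball x r s -> phi s = 0.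

Definition locally_zero_far n (phi : cochains R X n) :=
  exists S : K, forall x, far A S x -> germ_zero phi x.

Lemma coarsely_zero_compl n (phi : cochains R X n) :
  coarsely_zero phi -> compl_coarse_cochain A phi.
Proof.
move=> phi0 B AB r; have [S hS] := phi0 r.
have [M BM] := AB (Num.max S 1) ltac:(by rewrite le_max ler01 orbT).
exists (r + (M + r)) => u v.
have center w : (coarse_support (cochain_pull (val : B -> X) phi) `&`
    rnbhd r (@diagonal_evconst K B)) w ->
  exists2 x : B, (rnbhd (Num.max S 1) B `&` rnbhd (Num.max S 1) A) (val x) &
    forall i, mdist x (val w i) <= r.
  move=> [[s /= phis <-] /rnbhd_diagonalP[x xs _]]; exists x; last first.
    by move=> i; apply/ltW/xs.
  split.
    exists (val x); first exact: set_valP.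
    by apply: ballxx; rewrite lt_max ltr01 orbT.
  apply: contrapT => nx; apply: phis; apply: (hS (val x)) => //.
  by apply: (@far_le _ _ _ (Num.max S 1)); [rewrite le_max lexx|exact/farP].
move=> /center[x xS xu] /center[y yS yv]; apply: sup_dist_le => i.
apply: le_trans (metric_triangle _ x _) _; rewrite lerD//.
  by rewrite metric_sym.
by apply: le_trans (metric_triangle _ y _) _; rewrite lerD// (BM _ _ xS yS).
Qed.

Lemma compl_coarsely_zero n (phi : cochains R X n) :
  compl_coarse_cochain A phi -> coarsely_zero phi.
Proof.
have [a0 Aa0] := A0; move=> phiC; apply: contrapT => /existsNP[r /forallNP nS].
have /choice[p pP] : forall k : nat, exists p : X * ('I_n.+1 -> X),
    [/\ far A k%:R p.1, tuple_in_ball p.1 r p.2 & phi p.2 <> 0].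
  move=> k; have /existsNP[x /not_implyP[xk /existsNP[s /not_implyP[xs phis]]]] := nS k%:R.
  by exists (x, s).
pose B := [set y | exists k i, y = (p k).2 i].
have AB : coarsely_disjoint A B.
  move=> e e0; pose N := Num.bound (e + e + r).
  have r0 : 0 <= r by have [_ ps _] := pP 0%N; apply: ltW (le_lt_trans (mdist_ge0 _ _) (ps ord0)).
  pose M := \sum_(k < N) \sum_(i < n.+1) mdist a0 ((p k).2 i) + e.
  suff bM y : (rnbhd e B `&` rnbhd e A) y -> mdist a0 y <= M.
    exists (M + M) => y z /bM ya /bM za; apply: le_trans (metric_triangle _ a0 _) _.
    by rewrite lerD// metric_sym.
  move=> [[_ [k [i ->]] yB] [a Aa yA]]; rewrite ballEmdist /= in yB; rewrite ballEmdist /= in yA.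
  have [pk ps _] := pP k.
  have kN : (k < N)%N.
    rewrite -(ltr_nat K); apply: (@le_lt_trans _ _ (e + e + r)); last first.
      by apply: archi_boundP; rewrite !addr_ge0.
    have := pk a Aa; have := ps i; have := metric_triangle a y (p k).1.
    have := metric_triangle y ((p k).2 i) (p k).1.
    rewrite [mdist y ((p k).2 i)]metric_sym [mdist ((p k).2 i) (p k).1]metric_sym; lra.
  apply: le_trans (metric_triangle _ ((p k).2 i) _) _; rewrite lerD// ?(ltW yB)//.
  rewrite (bigD1 (Ordinal kN))//= (bigD1 i)//= -addrA lerDl addr_ge0 ?sumr_ge0// => *.
    exact: mdist_ge0.
  by apply: sumr_ge0 => *; apply: mdist_ge0.
have [M hM] := phiC B AB (r + r + 1).
have pB k i : (p k).2 i \in B by apply: mem_set; exists k, i.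
pose b k : 'I_n.+1 -> B := fun i => exist _ ((p k).2 i) (pB k i).
have bk k : (coarse_support (cochain_pull (val : B -> X) phi) `&`
    rnbhd (r + r + 1) (@diagonal_evconst K B)) (evconst_incl (b k)).
  have [pk ps phis] := pP k; split; first by exists (b k).
  exists (evconst_incl (fun _ : 'I_1 => b k ord0)); first by exists (fun=> b k ord0).
  rewrite ballEmdist /=; apply: (@le_lt_trans _ _ (r + r)); last by rewrite ltrDl.
  apply: sup_dist_le => i; rewrite evconst_incl_diag /=.
  apply: le_trans (metric_triangle _ (p k).1 _) _.
  by rewrite lerD// ?[mdist _ (p k).1]metric_sym ltW// ps.
pose x1 := (p 0%N).2 ord0; pose k := Num.bound (mdist a0 x1 + `|M| + `|r|).
have := hM _ _ (bk 0%N) (bk k) => /(le_trans (mdist_le_sup_dist _ _ 0%N)).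
rewrite (evconst_inclE (b 0%N) ord0) (evconst_inclE (b k) ord0).
rewrite -[mdist _ _]/(mdist x1 ((p k).2 ord0)) => d1.
have [pk ps _] := pP k.
have : mdist a0 x1 + `|M| + `|r| < k%:R by apply: archi_boundP; rewrite !addr_ge0// mdist_ge0.
have := pk a0 Aa0; have := ps ord0; have := ler_norm M; have := ler_norm r.
have := metric_triangle a0 x1 (p k).1; have := metric_triangle x1 ((p k).2 ord0) (p k).1.
rewrite [mdist ((p k).2 ord0) (p k).1]metric_sym; lra.
Qed.

Lemma coarsely_zeroP n (phi : cochains R X n) :
  reflect (coarsely_zero phi) (phi \in compl_coarse_cochains R A n).
Proof.
apply: (iffP idP) => [/asboolP|phi0]; first exact: compl_coarsely_zero.
exact/asboolP/coarsely_zero_compl.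
Qed.

Lemma coarsely_zero_locally n (phi : cochains R X n) :
  coarsely_zero phi -> locally_zero_far phi.
Proof.
by move=> /(_ 1)[S hS]; exists S => x xS; exists 1 => // s; apply: hS.
Qed.

Lemma locally_zero_far0 (phi : cochains R X 0) :
  locally_zero_far phi -> coarsely_zero phi.
Proof.
move=> [S hS] r; exists (S + r) => x xS s sr.
have [e e0 he] := hS _ (far_shift (ltW (sr ord0)) xS).
by apply: he => i; rewrite (ord1 i) mdistxx.
Qed.

Lemma germ_zero_list n (phi : cochains R X n) x :
  germ_zero phi x -> zero_near (list_cochain phi) x.
Proof.
move=> [e e0 phie]; exists e => // s se; have [sn|/eqP sn] := pselect (size s = n.+1).
  have [t tE ->] := list_cochainE phi sn; apply: phie => i; apply: se.
  by rewrite -tE; apply/mem_verticesP; exists i.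
exact: list_cochain_size.
Qed.

Lemma in_ball_vertices x r n (s : 'I_n -> X) :
  tuple_in_ball x r s -> in_ball x r (vertices s).
Proof. by move=> sr _ /mem_verticesP[i ->]. Qed.

Lemma cochain_primitive (hX : unif_contractible_at_infinity X) n
    (phi : cochains R X n.+1) :
  locally_zero_far phi -> coarsely_zero (cochain_delta phi) ->
  exists2 eta : cochains R X n, locally_zero_far eta & coarsely_zero (phi - cochain_delta eta).
Proof.
move=> [S hS] dphi.
have [||eta [[S1 h1] h2]] := far_primitive A0 hX (phi := list_cochain phi) n.+1.
- by exists S => x /hS; apply: germ_zero_list.
- move=> r; have [S' hS'] := dphi r; exists S' => x xS t tr.
  have [tn|/eqP tn] := pselect (size t = n.+3); last first.
    apply: delta_eq0 => u ut _; apply: list_cochain_size.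
    by apply: contra tn => /eqP un; rewrite -ut un.
  case: t tn tr => [//|y t] tn tr; rewrite -(vertices_nth y tn) -cochain_delta_list.
  apply: hS' xS _ _ => i; apply: tr.
  by rewrite -[X in _ \in X](vertices_nth y tn); apply/mem_verticesP; exists i.
exists (cochain_of_list eta).
  exists S1 => x /h1[e e0 he]; exists e => // s se; apply: he.
    exact: in_ball_vertices.
  by rewrite size_vertices.
move=> r; have [S2 hS2] := h2 r; exists S2 => x xS s sr.
rewrite cochain_of_list_delta -[LHS]/(phi s - delta eta (vertices s)).
rewrite (hS2 x) ?list_cochain_vertices ?subrr ?size_vertices//.
exact: in_ball_vertices.
Qed.

Lemma cochain_acyclic n (phi : cochains R X n.+1) :
  cochain_delta phi = 0 -> exists psi, phi = cochain_delta psi.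
Proof.
have [x _] := A0 => dphi.
exists (cochain_of_list (fun u => list_cochain phi (x :: u))).
apply/funext => s; rewrite cochain_of_list_delta /cochain_of_list.
have := congr1 (fun f => f (fun i : 'I_n.+3 => nth x (x :: vertices s) i)) dphi.
rewrite cochain_delta_list vertices_nth; last by rewrite /= size_vertices.
by rewrite /= list_cochain_vertices => /eqP; rewrite subr_eq0 => /eqP.
Qed.

Lemma cochain_constant (phi : cochains R X 0) :
  cochain_delta phi = 0 -> exists a : R^o, phi = cochain_cst a.
Proof.
have [x _] := A0 => dphi; exists (phi (fun=> x)); apply/funext => s.
have := congr1 (fun f => f (fun i : 'I_2 => nth x [:: x; s ord0] i)) dphi.
rewrite cochain_delta_list vertices_nth// /= subr0 => /eqP; rewrite subr_eq0.
by move=> /eqP e; apply: etrans (etrans _ e) _; congr phi; apply/funext => i;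
  rewrite (ord1 i).
Qed.

End CochainsFarAway.

Lemma lmod_isomorphic_of_rel (R : pzRingType) (V W : lmodType R) (L : V -> W -> Prop) :
  (forall a x y x' y', L x y -> L x' y' -> L (a *: x + x') (a *: y + y')) ->
  (forall x, exists y, L x y) -> (forall y, exists x, L x y) ->
  (forall y, L 0 y -> y = 0) -> (forall x, L x 0 -> x = 0) ->
  lmod_isomorphic V W.
Proof.
move=> Llin Ltot Lsurj Lfun Linj.
have Leq x y x' y' : L x y -> L x' y' -> L (x' - x) (y' - y).
  by move=> Lxy /(Llin (-1) _ _ _ _ Lxy); rewrite !scaleN1r ![- _ + _]addrC.
have /choice[f fL] := Ltot; have /choice[g gL] := Lsurj.
have f_linear : linear f.
  move=> a x y; have := Leq _ _ _ _ (Llin a _ _ _ _ (fL x) (fL y)) (fL (a *: x + y)).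
  by rewrite subrr => /Lfun /eqP; rewrite subr_eq0 => /eqP.
pose fM := GRing.isLinear.Build R V W *:%R f f_linear.
pose fl : {linear V -> W} := HB.pack f fM.
exists fl; exists g => [x|y] /=.
  have := Leq _ _ _ _ (gL (f x)) (fL x).
  by rewrite subrr => /Linj /eqP; rewrite subr_eq0 => /eqP.
have := Leq _ _ _ _ (gL y) (fL (g y)).
by rewrite subrr => /Lfun /eqP; rewrite subr_eq0 => /eqP.
Qed.

Definition in_submodule (R : pzRingType) (V : lmodType R) (P : lmodClosed V) x
  (Px : x \in P) : submodule P := exist (fun v => v \in P) x Px.

Lemma submodule_valP (R : pzRingType) (V : lmodType R) (P : lmodClosed V) a
  (u v : submodule P) : val (a *: u + v) = a *: val u + val v.
Proof. by []. Qed.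

Section ComplementGerms.
Variables (K : realType) (X : metricType K) (R : pzRingType) (A : set X).
Local Notation U S := (~` rnbhd S A).

Definition restrict_compl S n (phi : cochains R X n) : cochains R (U S) n :=
  cochain_pull (val : U S -> X) phi.
Arguments restrict_compl S {n} phi.

Lemma locally_zero_restrict S n (phi : cochains R X n) :
  (forall x, far A S x -> germ_zero phi x) -> locally_zero (restrict_compl S phi).
Proof.
move=> phi0; exists [set V | open V /\ forall s, (forall i, V (s i)) -> restrict_compl S phi s = 0].
split=> [V []//| |V [_]//]; apply/seteqP; split=> // x _.
have xS : far A S (val x) by apply/farP; exact: set_valP.
have [e e0 phie] := phi0 _ xS.
exists ((val : U S -> X) @^-1` (ball (val x) e)^°).
  split.
    apply: open_comp; last exact: open_interior.
    by move=> y _; exact: initial_continuous.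
  move=> s sV; apply: phie => i; have /interior_subset := sV i.
  by rewrite ballEmdist.
exact: nbhsx_ballx.
Qed.

Lemma germ_zero_restrict S n (phi : cochains R X n) :
  locally_zero (restrict_compl S phi) -> forall x, far A (S + 1) x -> germ_zero phi x.
Proof.
move=> [W [Wo WT W0]] x xS; have xU : x \in U S.
  by apply: mem_set; apply/farP; apply: far_le xS; rewrite lerDl.
pose x' : U S := exist _ x xU.
have [V WV Vx] : (\bigcup_(V in W) V) x' by rewrite WT.
have /nbhs_ballP[e /= e0 eV] : nbhs x' V by apply: open_nbhs_nbhs; split => //; exact: Wo.
exists (Num.min e 1); first by rewrite lt_min e0 ltr01.
move=> s se; have sU i : s i \in U S.
  apply: mem_set; apply/farP; apply: far_shift xS.
  by have := se i; rewrite lt_min => /andP[_ /ltW].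
have := W0 V WV (fun i => exist _ (s i) (sU i)); apply=> i; apply: eV.
by rewrite ballEmdist; have := se i; rewrite lt_min => /andP[].
Qed.

Lemma restrict_compl_surj S n (phi : cochains R (U S) n) :
  exists psi : cochains R X n, restrict_compl S psi = phi.
Proof.
exists (fun s => if pselect (forall i, s i \in U S) is left h then
  phi (fun i => exist _ (s i) (h i)) else 0).
apply/funext => s; rewrite /restrict_compl /cochain_pull.
case: pselect => [h|]; last by case=> i; exact: valP.
by congr phi; apply/funext => i; apply: val_inj.
Qed.

Lemma restrict_cocycle_bounds (A0 : A !=set0) S n (lam : cochains R X n) :
  cochain_delta lam = 0 ->
  exists u, augAS_d R (U S) n u = quot_pi _ (restrict_compl S lam).
Proof.
case: n lam => [|n] lam dlam.
  by have [a ->] := cochain_constant A0 dlam; exists a.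
have [zeta ->] := cochain_acyclic A0 dlam.
by exists (quot_pi _ (restrict_compl S zeta)); rewrite /= quot_map_pi.
Qed.

Lemma restrict_boundary S n (psi : cochains R X n) u :
  augAS_d R (U S) n u = quot_pi _ (restrict_compl S psi) ->
  exists2 lam : cochains R X n, cochain_delta lam = 0 &
    locally_zero (restrict_compl S (psi - lam)).
Proof.
case: n psi u => [|n] psi u /=.
  move=> /eqP; rewrite eq_sym quot_piE => /asboolP lz; exists (cochain_cst u) => //.
  by apply/funext => s; rewrite /cochain_delta big_ord_recl big_ord1 mul1r mulN1r subrr.
have [zeta zetaE] := restrict_compl_surj (repr u).
rewrite -(quot_pi_repr u) quot_map_pi -zetaE => /eqP; rewrite eq_sym quot_piE => /asboolP lz.
by exists (cochain_delta zeta) => //; exact: cochain_deltaK.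
Qed.

Section Comparison.
Hypothesis A0 : A !=set0.
Hypothesis hX : unif_contractible_at_infinity X.
Variable m : nat.

Local Notation CX := (compl_coarse_complex R A).
Local Notation AS S := (augAS_complex R (U S)).
Local Notation colim := (dlim (compl_system R A m)).

Definition AS_class S (w : cocycle (AS S) m.+1) : colim :=
  @dlim_in K R (compl_system R A m) S (quot_pi _ w).

Definition represents S (w : cocycle (AS S) m.+1) (psi : cochains R X m) :=
  val w = quot_pi _ (restrict_compl S psi).

Lemma represents_restrict S T (ST : S <= T) w psi : @represents S w psi ->
  exists w', [/\ @represents T w' psi, AS_class w' = AS_class w &
    quot_pi _ w' = dsys_map (compl_system R A m) ST (quot_pi _ w)].
Proof.
move=> wpsi.
pose restr := augAS_map R (@subset_incl_continuous X _ _ (@setC_rnbhdS K X A _ _ ST)).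
have mapE : quot_pi _ (cocycle_map restr m.+1 w) =
    dsys_map (compl_system R A m) ST (quot_pi _ w).
  by rewrite /= [RHS](cohomology_map_pi _ w).
exists (cocycle_map restr m.+1 w); split=> //.
  by apply: etrans (congr1 _ wpsi) _; exact: quot_map_pi.
by rewrite /AS_class mapE; exact: dlim_in_map.
Qed.

Lemma represents_ex S (psi : cochains R X m) :
  locally_zero (restrict_compl S (cochain_delta psi)) ->
  exists w, @represents S w psi.
Proof.
move=> lz.
have wP : quot_pi _ (restrict_compl S psi) \in ker (cochain_d (AS S) m.+1).
  rewrite unfold_in /= quot_map_pi -(linear0 (quot_pi _)) quot_piE subr0.
  exact/asboolP.
by exists (in_submodule wP).
Qed.

Definition corresponds (x : compl_coarse_cohomology R A m.+1) (y : colim) :=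
  exists psi S (z : cocycle CX m.+1) w,
    [/\ val (val z) = cochain_delta psi, @represents S w psi,
        x = quot_pi _ z & y = AS_class w].

Lemma compl_cocycle_ex (psi : cochains R X m) :
  coarsely_zero A (cochain_delta psi) ->
  exists z : cocycle CX m.+1, val (val z) = cochain_delta psi.
Proof.
move=> /(coarsely_zeroP A0) psiC.
pose phi : submodule (compl_coarse_cochains R A m.+1) := in_submodule psiC.
have phiK : phi \in ker (cochain_d CX m.+1).
  by rewrite unfold_in; apply/eqP/val_inj; rewrite /= cochain_deltaK.
by exists (in_submodule phiK).
Qed.

Lemma compl_cocycle_coarsely_zero (z : cocycle CX m.+1) : coarsely_zero A (val (val z)).
Proof. exact/(coarsely_zeroP A0)/valP. Qed.

Lemma corresponds_linear a x y x' y' : corresponds x y -> corresponds x' y' ->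
  corresponds (a *: x + x') (a *: y + y').
Proof.
move=> [psi [S [z [w [zpsi wpsi -> ->]]]]] [psi' [S' [z' [w' [zpsi' wpsi' -> ->]]]]].
have ST : S <= Num.max S S' by rewrite le_max lexx.
have S'T : S' <= Num.max S S' by rewrite le_max lexx orbT.
have [v [vpsi <- _]] := represents_restrict ST wpsi.
have [v' [vpsi' <- _]] := represents_restrict S'T wpsi'.
exists (a *: psi + psi'), (Num.max S S'), (a *: z + z'), (a *: v + v'); split.
- have dE : cochain_delta (a *: psi + psi') = a *: cochain_delta psi + cochain_delta psi'.
    exact: linearP.
  have vE' := submodule_valP (P := compl_coarse_cochains R A m.+1) a (val z) (val z').
  apply: etrans (etrans (congr1 val (submodule_valP a z z')) vE') _.
  by apply: etrans _ (esym dE); congr (_ *: _ + _).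
- rewrite /represents -[LHS]/(a *: val v + val v') vpsi vpsi'.
  by rewrite -linearP.
- by rewrite linearP.
- by rewrite /AS_class !linearP.
Qed.

Lemma corresponds_total x : exists y, corresponds x y.
Proof.
rewrite -(quot_pi_repr x); move: (repr x) => z.
have zC := compl_cocycle_coarsely_zero z.
have dz : cochain_delta (val (val z)) = 0.
  by have := valP z; rewrite unfold_in => /eqP/(congr1 val).
have [psi zpsi] := cochain_acyclic A0 dz.
have [S hS] := coarsely_zero_locally zC; rewrite zpsi in hS.
have [w wpsi] := represents_ex (locally_zero_restrict hS).
by exists (AS_class w), psi, S, z, w.
Qed.

Lemma corresponds_surj y : exists x, corresponds x y.
Proof.
have [S [x ->]] := dlim_inW y; rewrite -(quot_pi_repr x); move: (repr x) => w.
pose phi := repr (val w : Quotient.quot (locally_zero_cochains R (U S) m)).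
have [psi psiE] := restrict_compl_surj phi.
have wpsi : represents w psi by rewrite /represents psiE quot_pi_repr.
have lz : locally_zero (restrict_compl S (cochain_delta psi)).
  have := valP w; rewrite unfold_in wpsi /= quot_map_pi -(linear0 (quot_pi _)).
  by rewrite quot_piE subr0 => /asboolP.
have [|r|eta [T hT] psiC] := cochain_primitive A0 hX (phi := cochain_delta psi).
- by exists (S + 1); exact: germ_zero_restrict lz.
- by exists 0 => *; rewrite cochain_deltaK.
rewrite -linearB in psiC.
have [z zpsi] := compl_cocycle_ex psiC.
have SM : S <= Num.max S T by rewrite le_max lexx.
have [w' [w'psi w'w _]] := represents_restrict SM wpsi.
exists (quot_pi _ z), (psi - eta), (Num.max S T), z, w'; split=> //.
rewrite /represents w'psi; apply/eqP; rewrite quot_piE.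
apply/asboolP; have /locally_zero_restrict : forall x, far A (Num.max S T) x -> germ_zero eta x.
  by move=> x' /far_le x'T; apply: hT; apply: x'T; rewrite le_max lexx orbT.
suff -> : restrict_compl (Num.max S T) psi - restrict_compl (Num.max S T) (psi - eta) =
  restrict_compl (Num.max S T) eta by [].
by rewrite -linearB subKr.
Qed.

Lemma AS_class_eq0 S w psi (lam : cochains R X m) : @represents S w psi ->
  cochain_delta lam = 0 -> locally_zero_far A (psi - lam) -> AS_class w = 0.
Proof.
move=> wpsi dlam [T lamT]; have SM : S <= Num.max S T by rewrite le_max lexx.
have [w' [w'psi <- _]] := represents_restrict SM wpsi.
have [u du] := restrict_cocycle_bounds A0 (Num.max S T) dlam.
suff /eqP : quot_pi (coboundaries (AS (Num.max S T)) m.+1) w' == 0.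
  by rewrite /AS_class => ->; rewrite linear0.
rewrite -(linear0 (quot_pi _)) quot_piE subr0; apply/asboolP; exists u => //.
rewrite /= du w'psi; apply/eqP; rewrite eq_sym quot_piE; apply/asboolP.
have -> : restrict_compl (Num.max S T) psi - restrict_compl (Num.max S T) lam =
  restrict_compl (Num.max S T) (psi - lam) by [].
apply: locally_zero_restrict => x /far_le xT; apply: lamT; apply: xT.
by rewrite le_max lexx orbT.
Qed.

Lemma corresponds_functional y : corresponds 0 y -> y = 0.
Proof.
move=> [psi [S [z [w [zpsi wpsi z0 ->]]]]].
have /eqP := esym z0; rewrite -(linear0 (quot_pi _)) quot_piE subr0 => /asboolP /= [eta _ etaz].
apply: (AS_class_eq0 (lam := psi - val eta) wpsi).
  have etaE : cochain_delta psi = cochain_delta (val eta).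
    exact: etrans (esym zpsi) (congr1 val (esym etaz)).
  by rewrite cochain_deltaB etaE subrr.
rewrite subKr; apply: coarsely_zero_locally; exact/(coarsely_zeroP A0)/valP.
Qed.

Lemma AS_class0 S w psi : @represents S w psi -> AS_class w = 0 ->
  exists2 lam : cochains R X m, cochain_delta lam = cochain_delta psi & locally_zero_far A lam.
Proof.
move=> wpsi; rewrite -[RHS](linear0 (@dlim_in K R (compl_system R A m) S)).
move=> /dlim_inP[T [ST [ST']]]; rewrite linear0 => wT0.
have [w' [w'psi _ w'E]] := represents_restrict ST wpsi.
have /eqP := etrans w'E wT0.
rewrite -(linear0 (quot_pi _)) quot_piE subr0 => /asboolP /= [u _ uE].
have [lam dlam lamlz] := restrict_boundary (etrans uE w'psi).
exists (psi - lam); first by rewrite cochain_deltaB dlam subr0.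
by exists (T + 1); exact: germ_zero_restrict lamlz.
Qed.

Lemma corresponds_inj x : corresponds x 0 -> x = 0.
Proof.
move=> [psi [S [z [w [zpsi wpsi -> /esym w0]]]]].
have [lam dlam lamlz] := AS_class0 wpsi w0.
have [mu muC dmu] : exists2 mu, coarsely_zero A mu & cochain_delta mu = val (val z).
  rewrite zpsi -dlam; have := compl_cocycle_coarsely_zero z; rewrite zpsi -dlam.
  case: m lam lamlz {psi z w zpsi wpsi w0 dlam} => [|n] lam lamlz lamC.
    by exists lam => //; apply: locally_zero_far0.
  have [eta _ etaC] := cochain_primitive A0 hX lamlz lamC.
  by exists (lam - cochain_delta eta) => //; rewrite cochain_deltaB cochain_deltaK subr0.
apply/eqP; rewrite -(linear0 (quot_pi _)) quot_piE subr0; apply/asboolP => /=.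
exists (in_submodule (introT (coarsely_zeroP A0 _) muC)) => //.
exact: val_inj.
Qed.

End Comparison.
End ComplementGerms.

Theorem corollary1p4 (K : realType) (X : metricType K) (R : pzRingType)
    (A : set X) (hX : unif_contractible_at_infinity X) (hA0 : A !=set0)
    (hA : forall r : K, [set: X] <> rnbhd r A) (n : nat) (hn : (1 <= n)%N) :
  lmod_isomorphic (compl_coarse_cohomology R A n)
                  (dlim (compl_system R A n.-1)).
Proof.
case: n hn => [//|m] _; apply: (lmod_isomorphic_of_rel (L := @corresponds K X R A m)).
- move=> a x y x' y'; exact: corresponds_linear.
- exact: corresponds_total.
- exact: corresponds_surj.
- exact: corresponds_functional.
- exact: corresponds_inj.
Qed.
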